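(* Let $k\ge1$, $c,r\ge1$ with $c+r=k+1$, $R=(c^r)$, and let $\nu$ be a partition contained in $R$. Then $${\bf u}\big(V_{(R,\nu)/\nu}\big)=\tilde v_{\phi(\nu)}.$$ Consequently $\sum_{\nu\subseteq R}{\bf u}(V_{(R,\nu)/\nu})=Z_R:=\sum_{A}\tilde v_A$, the last sum over all $c$-element subsets $A$ of $\{0,1,\dots,k\}$.
   Context: Indices are modulo $k+1$. $W$ is the affine symmetric group with generators $s_0,\dots,s_k$ (relations $s_i^2=1$, $s_is_j=s_js_i$ for $i-j\not\equiv\pm1$, $s_is_{i+1}s_i=s_{i+1}s_is_{i+1}$); $\mathbb{A}$ is the affine nilCoxeter algebra with generators $u_0,\dots,u_k$ (relations $u_i^2=0$ and the same commutation and braid relations); for $w\in W$ with reduced word $s_{i_1}\cdots s_{i_m}$, ${\bf u}(w)=u_{i_1}\cdots u_{i_m}$. The content of the box in row $i$, column $j$ is $(j-i)\bmod(k+1)$. For a skew shape $\nu/\mu$, $V_{\nu/\mu}\in W$ is the product of $s_{\text{content}}$ over its boxes read row by row from the last (highest-indexed) row to row 1, each row right to left. For $\nu\subseteq R$, $(R,\nu)=(c,\dots,c,\nu_1,\nu_2,\dots)$ ($r$ copies of $c$). For a proper subset $D\subsetneq\{0,\dots,k\}$, $u_D\in\mathbb{A}$ is the product of the $u_m$, $m\in D$, each once, ordered so that whenever $j,j+1\in D$ (mod $k+1$), $u_{j+1}$ occurs left of $u_j$. For $A\subseteq\{0,\dots,k\}$ with $|A|=c$, let $A+d=\{i+d \bmod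 (k+1): i\in A\}$ and $\tilde v_A=u_Au_{A+1}u_{A+2}\cdots u_{A+r-1}$. For $\nu\subseteq R$, set $\nu_0=c$ and $\nu_d=0$ for $d$ larger than the number of parts of $\nu$, and $$\phi(\nu)=\bigcup_{j=0}^{r}\{\,i \bmod (k+1):\ \nu_{r-j}-2r+1+j> i\ge \nu_{r-j+1}-2r+1+j\,\}.$$ *)

(* Defs.v *)
From HB Require Import structures.
From mathcomp Require Import all_boot all_order all_algebra.
From mathcomp Require Import finmap.
From mathcomp Require Import monalg.
From mathcomp Require Import mathcomp_extra boolp classical_sets functions.
From mathcomp Require Import cardinality fsbigop.

Set Implicit Arguments.
Unset Strict Implicit.
Unset Printing Implicit Defensive.

Import GRing.Theory.
Local Open Scope quotient_scope.
Local Open Scope ring_scope.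

(* Indices modulo k + 1 are elements of 'I_k.+1; [ordS] is i |-> i + 1. *)
Definition adjacent (k : nat) (i j : 'I_k.+1) : bool :=
  (i == ordS j) || (j == ordS i).

Definition residue (k : nat) (z : int) : 'I_k.+1 :=
  inZp `|(z %% (k.+1 : int))%Z|%N.

(* The affine symmetric group: words in the generators, modulo the congruence
   generated by the Coxeter relations.  The braid relation is imposed for every
   i, also when k = 1. *)
Inductive cox_rel (k : nat) : seq 'I_k.+1 -> seq 'I_k.+1 -> Prop :=
| CoxSquare i : cox_rel [:: i; i] [::]
| CoxComm i j : ~~ adjacent i j -> cox_rel [:: i; j] [:: j; i]
| CoxBraid i : cox_rel [:: i; ordS i; i] [:: ordS i; i; ordS i].

Inductive cox_cong (k : nat) : seq 'I_k.+1 -> seq 'I_k.+1 -> Prop :=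
| CongStep x y a b : cox_rel a b -> cox_cong (x ++ a ++ y) (x ++ b ++ y)
| CongRefl a : cox_cong a a
| CongSym a b : cox_cong a b -> cox_cong b a
| CongTrans b a c : cox_cong a b -> cox_cong b c -> cox_cong a c.

Section AffineSymmetricGroup.
Variable k : nat.
Local Notation word := (seq 'I_k.+1).

Definition cox_eqv (a b : word) : bool := `[< cox_cong a b >].

Lemma cox_eqv_is_equiv : equiv_class_of cox_eqv.
Proof.
split=> [a|a b|b a c].
- by apply/asboolP; exact: CongRefl.
- by apply/asboolP/asboolP; exact: CongSym.
- by move=> /asboolP ab /asboolP bc; apply/asboolP; exact: CongTrans bc.
Qed.
Canonical cox_eqv_equiv := EquivRelPack cox_eqv_is_equiv.

Definition affW := {eq_quot cox_eqv}.
HB.instance Definition _ : EqQuotient word cox_eqv affW := EqQuotient.on affW.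
HB.instance Definition _ := Choice.on affW.

Lemma cox_cong_ctx (x y a b : word) :
  cox_cong a b -> cox_cong (x ++ a ++ y) (x ++ b ++ y).
Proof.
elim=> [x' y' a' b' ab|a'|a' b' _ h|b' a' c' _ h1 _ h2].
- by rewrite -!catA !(catA x x'); exact: CongStep.
- exact: CongRefl.
- exact: CongSym.
- exact: CongTrans h2.
Qed.

Lemma cox_cong_cat (a a' b b' : word) :
  cox_cong a a' -> cox_cong b b' -> cox_cong (a ++ b) (a' ++ b').
Proof.
move=> aa' bb'; apply: (@CongTrans _ (a' ++ b)).
  exact: (@cox_cong_ctx [::] b).
by have := @cox_cong_ctx a' [::] _ _ bb'; rewrite !cats0.
Qed.

Lemma cox_cong_rev (a b : word) : cox_cong a b -> cox_cong (rev a) (rev b).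
Proof.
elim=> [x y a' b' ab|a'|a' b' _ h|b' a' c' _ h1 _ h2].
- rewrite !rev_cat -!catA; apply: CongStep.
  by case: ab => [i|i j ij|i]; constructor; rewrite // /adjacent orbC.
- exact: CongRefl.
- exact: CongSym.
- exact: CongTrans h2.
Qed.

Lemma cox_cong_revK (a : word) : cox_cong (rev a ++ a) [::].
Proof.
elim: a => [|i a IH]; first exact: CongRefl.
rewrite rev_cons -cats1 -catA /=; apply: CongTrans IH.
exact: (CongStep (rev a) a (CoxSquare i)).
Qed.

Lemma affWP (a b : word) : \pi_affW a = \pi_affW b <-> cox_cong a b.
Proof.
split=> [/eqP|ab]; first by rewrite eqmodE => /asboolP.
by apply/eqP; rewrite eqmodE; apply/asboolP.
Qed.

Lemma affW_repr (a : word) : cox_cong (repr (\pi_affW a)) a.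
Proof. by apply/affWP; rewrite reprK. Qed.

Definition affW_one : affW := \pi_affW [::].
Definition affW_mul (v w : affW) : affW := \pi_affW (repr v ++ repr w).
Definition affW_inv (w : affW) : affW := \pi_affW (rev (repr w)).

Lemma pi_affW_mul (a b : word) :
  affW_mul (\pi_affW a) (\pi_affW b) = \pi_affW (a ++ b).
Proof. by apply/affWP/cox_cong_cat; exact: affW_repr. Qed.

Lemma pi_affW_inv (a : word) : affW_inv (\pi_affW a) = \pi_affW (rev a).
Proof. by apply/affWP/cox_cong_rev; exact: affW_repr. Qed.

Lemma affW_mulA : associative affW_mul.
Proof.
elim/quotW=> a; elim/quotW=> b; elim/quotW=> c.
by rewrite (pi_affW_mul b c) (pi_affW_mul a b) !pi_affW_mul catA.
Qed.

Lemma affW_mul1 : left_id affW_one affW_mul.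
Proof. by elim/quotW=> a; rewrite (pi_affW_mul [::] a). Qed.

Lemma affW_mulr1 : right_id affW_one affW_mul.
Proof. by elim/quotW=> a; rewrite (pi_affW_mul a [::]) cats0. Qed.

Lemma affW_mulV : left_inverse affW_one affW_inv affW_mul.
Proof.
elim/quotW=> a; rewrite pi_affW_inv (pi_affW_mul (rev a) a).
by apply/affWP; exact: cox_cong_revK.
Qed.

Lemma affW_mulrV : right_inverse affW_one affW_inv affW_mul.
Proof.
elim/quotW=> a; rewrite pi_affW_inv (pi_affW_mul a (rev a)).
by apply/affWP; have := cox_cong_revK (rev a); rewrite revK.
Qed.

HB.instance Definition _ := isGroup.Build affW
  affW_mulA affW_mul1 affW_mulr1 affW_mulV affW_mulrV.

Definition refl_s (i : 'I_k.+1) : affW := \pi_affW [:: i].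

Definition word_prod (a : word) : affW := (\prod_(i <- a) refl_s i)%g.

Lemma word_prodE (a : word) : word_prod a = \pi_affW a.
Proof.
rewrite /word_prod; elim: a => [|i a IH]; first by rewrite big_nil.
by rewrite big_cons IH; exact: pi_affW_mul.
Qed.

Definition reduced_word (w : affW) (a : word) : Prop :=
  word_prod a = w /\ forall b, word_prod b = w -> (size a <= size b)%N.

Lemma exists_reduced_word (w : affW) : exists a, reduced_word w a.
Proof.
have exP : exists n, `[< exists2 a, word_prod a = w & size a = n >].
  exists (size (repr w)); apply/asboolP; exists (repr w) => //.
  by rewrite word_prodE reprK.
case: (ex_minnP exP) => n /asboolP[a aw an] min_n.
exists a; split=> // b bw; rewrite an; apply: min_n.
by apply/asboolP; exists b.
Qed.

End AffineSymmetricGroup.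

(* The affine nilCoxeter algebra over F: the free algebra F<U_0, ..., U_k>
   (the algebra of the free monoid on 'I_k.+1) modulo the two-sided ideal
   generated by the nilCoxeter relations. *)
Section NilCoxeterAlgebra.
Variables (F : comNzRingType) (k : nat).
Local Notation freeA := {malg F[{fmonom 'I_k.+1}]}.

Definition freeU (i : 'I_k.+1) : freeA := << fmu i >>.

Inductive nil_rel : freeA -> Prop :=
| NilSquare i : nil_rel (freeU i * freeU i)
| NilComm i j : ~~ adjacent i j ->
    nil_rel (freeU i * freeU j - freeU j * freeU i)
| NilBraid i :
    nil_rel (freeU i * freeU (ordS i) * freeU i
             - freeU (ordS i) * freeU i * freeU (ordS i)).

Inductive nil_ideal : freeA -> Prop :=
| NilGen x : nil_rel x -> nil_ideal x
| Nil0 : nil_ideal 0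
| NilB x y : nil_ideal x -> nil_ideal y -> nil_ideal (x - y)
| NilMl a x : nil_ideal x -> nil_ideal (a * x)
| NilMr a x : nil_ideal x -> nil_ideal (x * a).

Definition nil_idealb : pred freeA := fun x => `[< nil_ideal x >].

Lemma nil_idealP x : reflect (nil_ideal x) (x \in nil_idealb).
Proof. exact: asboolP. Qed.

Lemma nil_ideal_zmod_closed : zmod_closed nil_idealb.
Proof.
split=> [|x y /nil_idealP xI /nil_idealP yI]; apply/nil_idealP.
  exact: Nil0.
exact: NilB.
Qed.
HB.instance Definition _ :=
  GRing.isZmodClosed.Build freeA nil_idealb nil_ideal_zmod_closed.

Definition nil_zmodClosed : zmodClosed freeA :=
  GRing.ZmodClosed.clone freeA nil_idealb _.

Definition nilA := Quotient.quot nil_zmodClosed.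
HB.instance Definition _ := GRing.Zmodule.on nilA.
HB.instance Definition _ :
  @isZmodQuotient freeA (Quotient.equiv nil_zmodClosed) 0 -%R +%R nilA :=
  ZmodQuotient.on nilA.

Lemma nilAP (x y : freeA) : \pi_nilA x = \pi_nilA y <-> nil_ideal (x - y).
Proof.
split=> [/eqP|xyI]; first by rewrite -Quotient.idealrBE => /nil_idealP.
by apply/eqP; rewrite -Quotient.idealrBE; apply/nil_idealP.
Qed.

Lemma pi_nilAD (x y : freeA) : \pi_nilA x + \pi_nilA y = \pi_nilA (x + y).
Proof. by rewrite pi_addr. Qed.

Lemma nilA_repr (x : freeA) : nil_ideal (repr (\pi_nilA x) - x).
Proof. by apply/nilAP; rewrite reprK. Qed.

Lemma nil_idealD x y : nil_ideal x -> nil_ideal y -> nil_ideal (x + y).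
Proof.
move=> xI yI; rewrite -[y]opprK; apply: NilB => //.
by rewrite -sub0r; apply: NilB => //; exact: Nil0.
Qed.

Definition nilA_one : nilA := \pi_nilA 1.
Definition nilA_mul (x y : nilA) : nilA := \pi_nilA (repr x * repr y).
Definition nilA_scale (c : F) (x : nilA) : nilA := \pi_nilA (c *: repr x).

Lemma pi_nilAM (x y : freeA) :
  nilA_mul (\pi_nilA x) (\pi_nilA y) = \pi_nilA (x * y).
Proof.
apply/nilAP; set x' := repr _; set y' := repr _.
have -> : x' * y' - x * y = (x' - x) * y' + x * (y' - y).
  by rewrite mulrBl mulrBr addrA subrK.
by apply: nil_idealD; [apply: NilMr | apply: NilMl]; exact: nilA_repr.
Qed.

Lemma pi_nilAZ c (x : freeA) :
  nilA_scale c (\pi_nilA x) = \pi_nilA (c *: x).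
Proof.
apply/nilAP; rewrite -scalerBr -mul_malgC.
by apply: NilMl; exact: nilA_repr.
Qed.

Lemma nilA_mulA : associative nilA_mul.
Proof.
elim/quotW=> a; elim/quotW=> b; elim/quotW=> c.
by rewrite (pi_nilAM b c) (pi_nilAM a b) !pi_nilAM mulrA.
Qed.

Lemma nilA_mul1 : left_id nilA_one nilA_mul.
Proof. by elim/quotW=> a; rewrite (pi_nilAM 1 a) mul1r. Qed.

Lemma nilA_mulr1 : right_id nilA_one nilA_mul.
Proof. by elim/quotW=> a; rewrite (pi_nilAM a 1) mulr1. Qed.

Lemma nilA_mulDl : left_distributive nilA_mul +%R.
Proof.
elim/quotW=> a; elim/quotW=> b; elim/quotW=> c.
rewrite (pi_nilAD a b) (pi_nilAM a c) (pi_nilAM b c) (pi_nilAM (a + b) c).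
by rewrite pi_nilAD mulrDl.
Qed.

Lemma nilA_mulDr : right_distributive nilA_mul +%R.
Proof.
elim/quotW=> a; elim/quotW=> b; elim/quotW=> c.
rewrite (pi_nilAD b c) (pi_nilAM a b) (pi_nilAM a c) (pi_nilAM a (b + c)).
by rewrite pi_nilAD mulrDr.
Qed.

Lemma nil_ideal_augment (x : freeA) : nil_ideal x -> x@_(mone : {fmonom _}) = 0.
Proof.
have U0 i : (freeU i)@_(mone : {fmonom _}) = 0.
  by rewrite mcoeffU1 fmP /= fmuE fm1.
elim=> {x} [x xR||x y _ xI _ yI|a x _ xI|a x _ xI].
- by case: xR => *; rewrite ?rmorphB ?rmorphM /= !U0 ?mulr0 ?mul0r ?subr0.
- exact: mcoeff0.
- by rewrite rmorphB /= xI yI subr0.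
- by rewrite rmorphM /= xI mulr0.
- by rewrite rmorphM /= xI mul0r.
Qed.

Lemma nilA_oner_neq0 : nilA_one != 0.
Proof.
apply/eqP => h; have : \pi_nilA 1 = \pi_nilA 0 by rewrite pi_zeror.
move=> /nilAP /nil_ideal_augment; rewrite subr0 rmorph1 => /eqP.
by rewrite oner_eq0.
Qed.

HB.instance Definition _ := GRing.Zmodule_isNzRing.Build nilA
  nilA_mulA nilA_mul1 nilA_mulr1 nilA_mulDl nilA_mulDr nilA_oner_neq0.

Lemma nilA_scaleA (c d : F) (x : nilA) :
  nilA_scale c (nilA_scale d x) = nilA_scale (c * d) x.
Proof.
elim/quotW: x => a.
by rewrite (pi_nilAZ d a) (pi_nilAZ c) (pi_nilAZ _ a) scalerA.
Qed.

Lemma nilA_scale1 : left_id 1 nilA_scale.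
Proof. by elim/quotW=> a; rewrite (pi_nilAZ 1 a) scale1r. Qed.

Lemma nilA_scaleDr : right_distributive nilA_scale +%R.
Proof.
move=> c; elim/quotW=> a; elim/quotW=> b.
rewrite (pi_nilAD a b) (pi_nilAZ c a) (pi_nilAZ c b) (pi_nilAZ c (a + b)).
by rewrite pi_nilAD scalerDr.
Qed.

Lemma nilA_scaleDl (x : nilA) : {morph nilA_scale^~ x : c d / c + d}.
Proof.
move=> c d; elim/quotW: x => a.
by rewrite (pi_nilAZ c a) (pi_nilAZ d a) (pi_nilAZ _ a) pi_nilAD scalerDl.
Qed.

HB.instance Definition _ := GRing.Zmodule_isLmodule.Build F nilA
  nilA_scaleA nilA_scale1 nilA_scaleDr nilA_scaleDl.

Lemma nilA_scaleAl (c : F) (x y : nilA) : c *: (x * y) = (c *: x) * y.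
Proof.
elim/quotW: x => a; elim/quotW: y => b.
rewrite [LHS](congr1 (nilA_scale c) (pi_nilAM a b)) (pi_nilAZ c (a * b)).
rewrite [RHS](congr1 (nilA_mul^~ _) (pi_nilAZ c a)) (pi_nilAM (c *: a) b).
by rewrite scalerAl.
Qed.

HB.instance Definition _ := GRing.Lmodule_isLalgebra.Build F nilA nilA_scaleAl.

Lemma mulr_malgC (c : F) (x : freeA) : x * c%:MP = c *: x.
Proof.
rewrite malgM_def malgZ_def fgmulgU /fgscale; apply: eq_bigr => i _.
by rewrite mulm1 mulrC.
Qed.

Lemma nilA_scaleAr (c : F) (x y : nilA) : c *: (x * y) = x * (c *: y).
Proof.
elim/quotW: x => a; elim/quotW: y => b.
rewrite [LHS](congr1 (nilA_scale c) (pi_nilAM a b)) (pi_nilAZ c (a * b)).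
rewrite [RHS](congr1 (nilA_mul _) (pi_nilAZ c b)) (pi_nilAM a (c *: b)).
by rewrite -!mul_malgC !mulrA mulr_malgC mul_malgC.
Qed.

HB.instance Definition _ := GRing.Lalgebra_isAlgebra.Build F nilA nilA_scaleAr.

Definition gen_u (i : 'I_k.+1) : nilA := \pi_nilA (freeU i).

(* By Matsumoto's theorem the value does not depend on the reduced word that
   is chosen. *)
Definition nil_u (w : affW k) : nilA :=
  \prod_(i <- projT1 (cid (exists_reduced_word w))) gen_u i.

Definition cyc_decreasing (D : {set 'I_k.+1}) (a : seq 'I_k.+1) : bool :=
  [&& uniq a, [forall i, (i \in a) == (i \in D)] &
      [forall j in D, (ordS j \in D) ==> (index (ordS j) a < index j a)%N]].

(* All cyc_decreasing listings of a proper subset D give the same product.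
   When D is the full index set there is none, and u_set D is 1. *)
Definition u_set (D : {set 'I_k.+1}) : nilA :=
  \prod_(i <- head [::] [seq a <- permutations (enum D) | cyc_decreasing D a])
    gen_u i.

Definition shift_set (A : {set 'I_k.+1}) (d : nat) : {set 'I_k.+1} :=
  [set inZp (i + d)%N | i : 'I_k.+1 in A].

Definition v_tilde (r : nat) (A : {set 'I_k.+1}) : nilA :=
  \prod_(0 <= d < r) u_set (shift_set A d).

Definition Z_rect (c r : nat) : nilA :=
  \sum_(A : {set 'I_k.+1} | #|A| == c) v_tilde r A.

End NilCoxeterAlgebra.

(* Partitions are weakly decreasing sequences of positive integers; the part
   nu_d (d >= 1) is nth 0 nu d.-1, and rows and columns are counted from 0. *)
Definition is_partition (nu : seq nat) : bool :=
  sorted geq nu && (0%N \notin nu).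

Definition part_incl (mu nu : seq nat) : Prop :=
  forall i, (nth 0%N mu i <= nth 0%N nu i)%N.

Definition rect (c r : nat) : seq nat := nseq r c.

Definition partitions_in (la : seq nat) : set (seq nat) :=
  [set nu | is_partition nu /\ part_incl nu la]%classic.

(* The cells of row i of la/mu are (i, j) with mu_i <= j < la_i. *)
Definition skew_word (k : nat) (la mu : seq nat) : seq 'I_k.+1 :=
  flatten
    [seq [seq residue k (j%:Z - i%:Z) |
           j : nat <- rev (iota (nth 0%N mu i) (nth 0%N la i - nth 0%N mu i))] |
     i : nat <- rev (iota 0 (size la))].

Definition skew_V (k : nat) (la mu : seq nat) : affW k :=
  word_prod (skew_word k la mu).

(* nu_0 = c, hence nu_d = nth 0 (c :: nu) d for all d >= 0. *)
Definition phi (k c r : nat) (nu : seq nat) : {set 'I_k.+1} :=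
  let part d := (nth 0%N (c :: nu) d)%:Z in
  (\bigcup_(j < r.+1)
     [set m : 'I_k.+1 | `[< exists i : int,
        [/\ part (r - j)%N - 2 * r%:Z + 1 + j%:Z > i,
            i >= part (r - j).+1%N - 2 * r%:Z + 1 + j%:Z &
            m = residue k i] >]])%SET.

Lemma partition_nz (nu : seq nat) : is_partition nu ->
  nu = [seq x <- nu | x != 0%N].
Proof.
case/andP=> _ nz; symmetry; apply/all_filterP/allP => x xnu.
by apply: contraNneq nz => <-.
Qed.

(* The sum over partitions contained in a rectangle is a finite sum. *)
Lemma finite_partitions_in_rect (c r : nat) :
  finite_set (partitions_in (rect c r)).
Proof.
pose f (t : r.-tuple 'I_c.+1) := [seq x <- map val t | x != 0%N].
apply: (@sub_finite_set _ _ (f @` setT)%classic); last first.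
  by apply: finite_image; exact: finite_finset.
move=> nu [nup nuR] /=.
exists [tuple inord (nth 0%N nu i) | i < r] => //.
have sz : (size nu <= r)%N.
  rewrite leqNgt; apply/negP => ltr.
  have := nuR r; rewrite nth_nseq ltnn leqn0 => /eqP h0.
  by case/andP: nup => _ /negP; apply; rewrite -h0 mem_nth.
have -> : f [tuple inord (nth 0%N nu i) | i < r]
    = [seq x <- nu ++ nseq (r - size nu) 0%N | x != 0%N].
  rewrite /f; congr filter; apply: (@eq_from_nth _ 0%N).
    by rewrite size_map size_tuple size_cat size_nseq subnKC.
  move=> i; rewrite size_map size_tuple => ir.
  rewrite (nth_map ord0) ?size_tuple // -[i]/(val (Ordinal ir)).
  rewrite -tnth_nth tnth_mktuple [LHS]inordK; last first.
    by rewrite ltnS; have := nuR i; rewrite nth_nseq ir.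
  rewrite nth_cat; case: ltnP => // szi.
  by rewrite nth_nseq if_same nth_default.
rewrite filter_cat -partition_nz // -[RHS]cats0; congr cat.
by apply/eqP; rewrite -[_ == _]negbK -has_filter; apply/hasPn=> x /nseqP[->].
Qed.

(* Main.v *)
Require Import Defs.
From HB Require Import structures.
From mathcomp Require Import all_boot all_order all_algebra.
From mathcomp Require Import finmap.
From mathcomp Require Import monalg.
From mathcomp Require Import mathcomp_extra boolp classical_sets functions.
From mathcomp Require Import cardinality fsbigop.
From mathcomp Require Import perm zify ring.

Set Implicit Arguments.
Unset Strict Implicit.
Unset Printing Implicit Defensive.

Import GRing.Theory.
Local Open Scope ring_scope.

(* Both sides are computed in the affine symmetric group W and then lifted to
   the nilCoxeter algebra by Matsumoto's theorem.  Enlarging nu by a cell of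
   content x removes a letter s_x at the right end of V_{(R,nu)/nu} and adds
   s_{x-r} at the left end; in phi(nu) it replaces an element m by m - 1, which
   conjugates the product of the cyclically decreasing words of
   phi(nu), phi(nu) + 1, ..., phi(nu) + r - 1 in exactly the same way.
   Induction from the empty partition gives the equality in W.
   This second word is reduced: let s_i exchange the contents of the sites i and
   i + 1 of a cycle carrying particles at the sites of A.  The word moves each of
   the c particles r steps forward, while one letter changes the total
   displacement by at most 1, so at least c r letters are needed.
   Finally, the complement of phi(nu) records the r vertical steps of the
   boundary path of nu, so that phi is a bijection onto the c-subsets. *)

(** * Residues modulo k + 1 *)

Section Residues.
Variable k : nat.
Local Notation n := (k.+1%:Z).

Lemma residueP (x y : int) :
  reflect (exists q : int, x = y + q * n) (residue k x == residue k y).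
Proof.
have val_res z : (residue k z : nat)%:Z = (z %% n)%Z.
  have z0 : 0 <= (z %% n)%Z by rewrite modz_ge0.
  have zn : (z %% n)%Z < n by rewrite ltz_pmod.
  by rewrite /residue /= modn_small; lia.
apply: (iffP eqP) => [e|[q ->]].
  have := val_res x; rewrite e val_res => e'.
  exists ((x %/ n)%Z - (y %/ n)%Z).
  move: (divz_eq x n) (divz_eq y n); rewrite -e'.
  move: (x %/ n)%Z (y %/ n)%Z (y %% n)%Z => u v w -> ->; ring.
apply: val_inj; apply/eqP; rewrite -eqz_nat !val_res.
by rewrite addrC modzMDl.
Qed.

Lemma residue_val (i : 'I_k.+1) : residue k i = i.
Proof.
apply: val_inj; rewrite /residue /= modz_nat absz_nat modn_mod modn_small //.
Qed.

Lemma ordS_residue (x : int) : ordS (residue k x) = residue k (x + 1).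
Proof.
set i := residue k x.
have -> : ordS i = residue k (i%:Z + 1).
  apply: val_inj; rewrite /residue /= -PoszD modz_nat absz_nat addn1 modn_mod.
  by [].
have /eqP/residueP[q e] : residue k i = residue k x by rewrite residue_val.
by apply/eqP/residueP; exists q; rewrite e; ring.
Qed.

Lemma residue_inj_window (a x y : int) :
  a <= x < a + n -> a <= y < a + n -> residue k x = residue k y -> x = y.
Proof.
move=> hx hy /eqP/residueP[q e].
have : q = 0 by nia.
by move=> q0; rewrite e q0; lia.
Qed.

Lemma residue_surj (a : int) (i : 'I_k.+1) :
  exists2 x : int, a <= x < a + n & i = residue k x.
Proof.
exists (a + ((i%:Z - a) %% n)%Z).
  have : 0 <= ((i%:Z - a) %% n)%Z by rewrite modz_ge0.
  have : ((i%:Z - a) %% n)%Z < n by rewrite ltz_pmod.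
  by lia.
rewrite -[LHS]residue_val; apply/eqP/residueP.
exists ((i%:Z - a) %/ n)%Z.
move: (divz_eq (i%:Z - a) n); move: (_ %/ _)%Z (_ %% _)%Z => u v e.
by rewrite -[LHS](subrK a) e; ring.
Qed.

Lemma no_small_multiple (d q : int) : 0 < d < n -> d = q * n -> False.
Proof.
move=> h e; have [q0|q0] : q <= 0 \/ 0 < q by lia.
  by nia.
have : 1 <= q by lia.
nia.
Qed.

Lemma nonadjacent_residue (x z : int) :
  x + 2 <= z < x + k%:Z -> ~~ adjacent (residue k x) (residue k z).
Proof.
move=> h; apply/negP; rewrite /adjacent !ordS_residue.
case/orP => /residueP[q e].
  by apply: (@no_small_multiple (z + 1 - x) (- q)); [lia | rewrite e; ring].
by apply: (@no_small_multiple (z - (x + 1)) q); [lia | rewrite e; ring].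
Qed.

Lemma adjacentC (i j : 'I_k.+1) : adjacent i j = adjacent j i.
Proof. by rewrite /adjacent orbC. Qed.

End Residues.

(** * Particle displacement *)

Section Displacement.
Variable k : nat.
Local Notation I := 'I_k.+1.
Local Notation word := (seq I).
Implicit Types (S : pred I) (a b : word) (i j : I).

Definition swap_site i S : pred I := S \o tperm i (ordS i).

Definition move a S : pred I := foldl (fun T i => swap_site i T) S a.

(* View S as the positions of particles on a cycle; s_i exchanges the contents
   of the sites i and i + 1, and [disp] is the total signed displacement. *)
Fixpoint disp a S : int :=
  if a is i :: a' then
    (S i)%:Z - (S (ordS i))%:Z + disp a' (swap_site i S)
  else 0.

Lemma move_cat a b S : move (a ++ b) S = move b (move a S).
Proof. by rewrite /move foldl_cat. Qed.

Lemma disp_cat a b S : disp (a ++ b) S = disp a S + disp b (move a S).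
Proof.
by elim: a S => [|i a IH] S /=; rewrite ?add0r // IH addrA.
Qed.

Lemma disp_le a S : disp a S <= (size a)%:Z.
Proof.
elim: a S => [|i a IH] S //=.
have := IH (swap_site i S); move: (disp _ _) => d; rewrite -[(size a).+1]addn1 PoszD.
by case: (S i); case: (S (ordS i)) => /=; lia.
Qed.

Hypothesis k_gt0 : (0 < k)%N.

Lemma ordS_neq i : ordS i != i.
Proof.
apply/eqP; rewrite -[in RHS](residue_val i) -[in LHS](residue_val i).
rewrite ordS_residue => /eqP/residueP[q e].
by apply: (@no_small_multiple k 1 q); [lia | apply: (addrI i%:Z)].
Qed.

(* For k = 1 the braid relation only preserves the displacement modulo 6;
   for k > 1 the modulus 0 makes the congruence an equality. *)
Definition disp_mod : int := if k == 1%N then 6 else 0.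

Lemma ordSS_eq i : (ordS (ordS i) == i) = (k == 1)%N.
Proof.
rewrite -(residue_val i) !ordS_residue.
apply/residueP/eqP => [[q e]|k1].
  apply/eqP; apply: contraT => k1.
  by case: (@no_small_multiple k 2 q); [lia | apply: (addrI i%:Z); rewrite -e; ring].
by exists 1; rewrite mul1r -addrA; congr (_ + _); lia.
Qed.

(** A square is a hop and its reversal, and commuting letters act on disjoint pairs of sites. Both
    braid words exchange the contents of [i] and [i + 2], with displacement twice the difference of
    these contents. For [k = 1], where [i + 2 = i], their displacements are [3 * (S i - S j)] and
    its opposite. *)
Lemma cox_rel_disp a b S : cox_rel a b ->
  move a S = move b S /\ (disp a S = disp b S %[mod disp_mod])%Z.
Proof.
case=> [i|i j ij|i].
- split=> /=.
    by rewrite /swap_site; apply/funext => x /=; rewrite tpermK.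
  by congr (_ %% _)%Z; rewrite /= /swap_site /= tpermL tpermR; ring.
- have [->|nij] := eqVneq i j; first by [].
  move: ij; rewrite /adjacent negb_or => /andP[n1 n2].
  have n3 : ordS i != ordS j by rewrite (inj_eq (@ordS_inj _)).
  have ni := ordS_neq i; have nj := ordS_neq j.
  have n1' := n1; have n2' := n2; have n3' := n3; have nij' := nij.
  rewrite eq_sym in n1'; rewrite eq_sym in n2'.
  rewrite eq_sym in n3'; rewrite eq_sym in nij'.
  split.
    apply/funext => x /=; congr S; rewrite -!permM; congr (fun_of_perm _ x).
    apply/esym/commgP; rewrite -conjg_fix tpermJ.
    by rewrite !tpermD.
  by congr (_ %% _)%Z; rewrite /= /swap_site /= !tpermD //; ring.
- set j := ordS i; set l := ordS j.
  have nij : i != j by rewrite eq_sym ordS_neq.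
  have njl : j != l by rewrite eq_sym ordS_neq.
  have nji := nij; rewrite eq_sym in nji.
  have nlj := njl; rewrite eq_sym in nlj.
  have := ordSS_eq i; rewrite -/j -/l.
  have [li /esym k1|nli /esym k1] := eqVneq l i.
    have tC : tperm j l = tperm i j by rewrite li tpermC.
    split=> /=; first by rewrite /swap_site -/j -/l tC.
    rewrite /= /swap_site /= -/j -/l tC /disp_mod k1 li /= !(tpermL, tpermR).
    apply/eqP; rewrite eqz_mod_dvd; apply/dvdzP.
    by exists ((S i)%:Z - (S j)%:Z); ring.
  have nil := nli; rewrite eq_sym in nil.
  split=> /=.
    apply/funext => x /=; congr S; rewrite -/j -/l -!permM.
    have tJ (u v w : I) : u != w -> v != w ->
        (tperm u v * (tperm v w * tperm u v) = tperm u w)%g.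
      move=> nuw nvw; rewrite -[in X in (X * _)%g]tpermV -conjgE tpermJ tpermR.
      by rewrite tpermD // eq_sym.
    congr (fun_of_perm _ x).
    have := tJ l j i nli nji.
    rewrite [tperm l j]tpermC [tperm j i]tpermC [tperm l i]tpermC => h.
    by rewrite -?mulgA h tJ.
  congr (_ %% _)%Z; rewrite /= /swap_site /= -/j -/l.
  rewrite !(tpermL, tpermR) [tperm i j l]tpermD // [tperm j l i]tpermD //.
  by rewrite !(tpermL, tpermR); ring.
Qed.

Lemma cox_cong_disp a b : cox_cong a b -> forall S,
  move a S = move b S /\ (disp a S = disp b S %[mod disp_mod])%Z.
Proof.
elim=> {a b} [x y a b ab S|a S|a b _ IH S|b a c _ IH1 _ IH2 S].
- have [m d] := cox_rel_disp (move x S) ab.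
  rewrite !move_cat !disp_cat m; split=> //.
  by apply/eqP; rewrite eqz_modDl eqz_modDr; apply/eqP.
- by [].
- by have [-> ->] := IH S.
- by have [-> ->] := IH1 S; have [-> ->] := IH2 S.
Qed.

Lemma disp_mod1 (x : int) : -1 <= x <= 0 -> (1 == x %[mod disp_mod])%Z = false.
Proof.
move=> hx; apply/negP; rewrite eqz_mod_dvd => /dvdzP[q].
rewrite /disp_mod; case: ifP => _ e; lia.
Qed.

(** A single particle at site [i] is displaced by 1 under [s_i] and by 0 or -1 under any other
    letter; these stay distinct modulo [disp_mod]. *)
Lemma refl_s_inj : injective (@refl_s k).
Proof.
move=> i j /affWP/cox_cong_disp/(_ (pred1 i))[_ /eqP].
have -> : disp [:: i] (pred1 i) = 1.
  by rewrite /= eqxx (negbTE (ordS_neq i)).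
have [//|nij] := eqVneq i j.
rewrite eq_sym in nij; rewrite disp_mod1 //= (negbTE nij).
by case: (_ == _).
Qed.

End Displacement.

(** * The exchange condition and Matsumoto's theorem *)

Section Matsumoto.
Variable k : nat.
Hypothesis k_gt0 : (0 < k)%N.
Local Notation I := 'I_k.+1.
Local Notation word := (seq I).
Local Notation W := (affW k).
Local Notation s := (@refl_s k).
Local Notation wp := (@word_prod k).
Implicit Types (a b c : word) (i j : I) (t : W).

Lemma word_prod_nil : wp [::] = 1%g.
Proof. by rewrite /word_prod big_nil. Qed.

Lemma word_prod_cons i a : wp (i :: a) = (s i * wp a)%g.
Proof. by rewrite /word_prod big_cons. Qed.

Lemma word_prod_cat a b : wp (a ++ b) = (wp a * wp b)%g.
Proof. by rewrite /word_prod big_cat. Qed.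

Lemma word_prod_eqP a b : wp a = wp b <-> cox_cong a b.
Proof. by rewrite !word_prodE; exact: affWP. Qed.

Lemma refl_sK i : (s i * s i)%g = 1%g :> W.
Proof.
rewrite -word_prod_nil -[(s i * s i)%g]mulg1 -word_prod_nil -mulgA -!word_prod_cons.
by apply/word_prod_eqP; exact: (CongStep [::] [::] (CoxSquare i)).
Qed.

Lemma refl_sKl i : cancel ( *%g (s i)) ( *%g (s i)).
Proof. by move=> t; rewrite mulgA refl_sK mul1g. Qed.

Lemma refl_sKr i : cancel (fun t => t * s i)%g (fun t => t * s i)%g.
Proof. by move=> t; rewrite -mulgA refl_sK mulg1. Qed.

Lemma refl_sV i : (s i)^-1%g = s i.
Proof. by apply: mulg1_eq; exact: refl_sK. Qed.

Lemma refl_s_comm i j : ~~ adjacent i j -> (s i * s j = s j * s i)%g.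
Proof.
move=> ij; have /word_prod_eqP := CongStep [::] [::] (CoxComm ij).
by rewrite /= !word_prod_cons word_prod_nil !mulg1.
Qed.

Lemma refl_s_braid i j : adjacent i j ->
  (s i * (s j * s i) = s j * (s i * s j))%g.
Proof.
have br l : (s l * (s (ordS l) * s l) = s (ordS l) * (s l * s (ordS l)))%g.
  have /word_prod_eqP := CongStep [::] [::] (CoxBraid l).
  by rewrite /= !word_prod_cons word_prod_nil !mulg1.
by case/orP => /eqP->.
Qed.

(** The left inversion sequence of a word [i_1 ... i_m]: the conjugates of [s_{i_l}] by the prefixes
    [s_{i_1} ... s_{i_{l-1}}]. *)
Fixpoint reflections a : seq W :=
  if a is i :: a' then s i :: [seq (t ^ s i)%g | t <- reflections a']
  else [::].

Lemma reflections_cat a b : reflections (a ++ b) =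
  reflections a ++ [seq (t ^ (wp a)^-1)%g | t <- reflections b].
Proof.
elim: a => [|i a IH] /=.
  rewrite word_prod_nil; elim: (reflections b) => //= t l <-.
  by rewrite invg1 conjg1.
rewrite IH map_cat -map_comp; congr (_ :: _ ++ _); apply: eq_map => t /=.
by rewrite word_prod_cons invgM refl_sV conjgM.
Qed.

Lemma count_conj t u (l : seq W) :
  count_mem t [seq (v ^ u)%g | v <- l] = count_mem (t ^ u^-1)%g l.
Proof.
rewrite count_map; apply: eq_count => v /=.
by rewrite -[in RHS](inj_eq (conjg_inj u)) conjgKV.
Qed.

(** The sequence changes by two equal entries under a square, by a swap of two entries under a
    commutation, and by the reversal of three entries under a braid; parities survive all three. *)
Lemma odd_reflections a b : cox_cong a b -> forall t,
  odd (count_mem t (reflections a)) = odd (count_mem t (reflections b)).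
Proof.
elim=> {a b} [x y a b ab t|//|a b _ IH t|b a c _ IH1 _ IH2 t]; first last.
- by rewrite IH1.
- by rewrite IH.
have eab : wp a = wp b.
  by apply/word_prod_eqP; have := CongStep [::] [::] ab; rewrite /= !cats0.
rewrite !reflections_cat !map_cat !count_cat !oddD eab.
congr (_ (+) (_ (+) _)); rewrite !count_conj; move: (t ^ _)%g => {}t.
case: ab {eab} => [i|i j ij|i] /=.
- by rewrite conjgE refl_sV refl_sKl addn0; case: (_ == _).
- have c1 : (s j ^ s i = s j)%g.
    by rewrite conjgE -(refl_s_comm ij) refl_sV refl_sKl.
  rewrite c1; have c2 : (s i ^ s j = s i)%g.
    by rewrite conjgE (refl_s_comm ij) refl_sV refl_sKl.
  by rewrite c2 !addn0 addnC.
- set j := ordS i.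
  have ij : adjacent i j by rewrite /adjacent eqxx orbT.
  have c1 : (s j ^ s i = s i ^ s j)%g.
    by rewrite !conjgE !refl_sV refl_s_braid.
  have c2 : ((s i ^ s j) ^ s i = s j)%g.
    by rewrite -c1 -conjgM refl_sK conjg1.
  have c3 : ((s j ^ s i) ^ s j = s i)%g.
    by rewrite c1 -conjgM refl_sK conjg1.
  by rewrite c1 c2 -c1 c3 !addn0 addnCA addnA [in RHS]addnC.
Qed.

(** If [t] comes from the letter [i], it is the prefix before [i], then [s i], then the inverse
    prefix, so in [t * wp a] the prefix and [s i] cancel and only the letter [i] is lost. *)
Lemma reflections_exchange t a : t \in reflections a ->
  exists a1 i a2, a = a1 ++ i :: a2 /\ wp (a1 ++ a2) = (t * wp a)%g.
Proof.
elim: a t => [//|i a IH] t /=; rewrite inE => /orP[/eqP->|/mapP[u /IH]].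
  by exists [::], i, a; rewrite word_prod_cons refl_sKl.
move=> [a1 [j [a2 [-> e]]]] ->; exists (i :: a1), j, a2; split=> //=.
by rewrite !word_prod_cons e conjgE refl_sV !mulgA refl_sKr.
Qed.

Definition reduced a := forall b, wp b = wp a -> (size a <= size b)%N.

Lemma reduced_wordE w a : reduced_word w a <-> wp a = w /\ reduced a.
Proof.
by split=> [[<- h]|[<- h]]; split=> // b e; apply: h.
Qed.

Lemma reduced_catr a b : reduced (a ++ b) -> reduced b.
Proof.
move=> red c e; have := red (a ++ c); rewrite !word_prod_cat e !size_cat.
by rewrite leq_add2l; exact.
Qed.

(** Otherwise [s i] would occur an odd number of times in [reflections (i :: a)], hence also occur
    in [reflections b]; deleting the matching letter of [b] would give a word for [wp a] shorter
    than [a]. *)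
Lemma left_exchange i a b : reduced a -> wp b = (s i * wp a)%g ->
  (size b < size a)%N -> s i \in reflections a.
Proof.
move=> red e sz; apply: contraT => nia.
have /odd_reflections/(_ (s i)) : cox_cong (i :: a) b.
  by apply/word_prod_eqP; rewrite word_prod_cons e.
rewrite /= eqxx count_conj [(_ ^ (s i)^-1)%g]conjgE invgK refl_sV refl_sKl.
rewrite (count_memPn nia) /= => /esym ob.
have : s i \in reflections b by rewrite -has_pred1 has_count; case: count ob.
move=> /reflections_exchange[b1 [j [b2 [eb eb']]]].
have := red (b1 ++ b2); rewrite eb' e refl_sKl => /(_ erefl).
by move: sz; rewrite eb !size_cat /= => ? ?; lia.
Qed.

(* The exchange condition turns two reduced words starting with different
   letters i and j into words starting with the two sides of a relation
   between i and j, to which the induction hypothesis applies. *)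
Lemma matsumoto (A : nzRingType) (f : I -> A)
    (f_comm : forall i j, ~~ adjacent i j -> f i * f j = f j * f i)
    (f_braid : forall i, f i * f (ordS i) * f i = f (ordS i) * f i * f (ordS i))
    a b : reduced a -> reduced b -> wp a = wp b ->
  \prod_(i <- a) f i = \prod_(i <- b) f i.
Proof.
have f_braid' i j : adjacent i j -> f i * f j * f i = f j * f i * f j.
  by case/orP => /eqP->; rewrite f_braid.
elim: {a}(size a).+1 {-2}a (ltnSn (size a)) b => // N IH a aN b ra rb e.
have sz : size a = size b.
  by apply/eqP; rewrite eqn_leq ra ?rb.
case: a b => [|i a] [|j b] // in aN ra rb e sz *.
move: sz => /= [sz]; rewrite ltnS /= in aN.
have ra' : reduced a by exact: (@reduced_catr [:: i]).
have rb' : reduced b by exact: (@reduced_catr [:: j]).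
have IHa c : size c = size a -> wp c = wp a ->
    \prod_(i <- a) f i = \prod_(i <- c) f i.
  by move=> szc ec; apply: IH => // d; rewrite szc ec; apply: ra'.
have [eij|nij] := eqVneq i j.
  rewrite !big_cons eij (IHa b) //.
  by apply: (mulgI (s j)); rewrite -!word_prod_cons -e eij.
(* Multiplication by [s i] shortens [j :: b], so a letter of it can be deleted. This is not [j],
   since [i] and [j] differ; deleting it from [b] leaves [c], and [j :: c] represents the same
   element as [a]. *)
have e1 : wp a = (s i * wp (j :: b))%g.
  by rewrite -e word_prod_cons refl_sKl.
have := left_exchange rb e1; rewrite /= -sz ltnS leqnn => /(_ isT).
rewrite inE => /orP[/eqP/(refl_s_inj k_gt0) eij|].
  by rewrite eij eqxx in nij.
case/mapP => u /reflections_exchange[b1 [l [b2 [eb eb']]]] eu.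
pose c := b1 ++ b2.
have ec : wp (j :: c) = wp a.
  rewrite word_prod_cons /c eb' e1 word_prod_cons eu conjgE refl_sV.
  by rewrite !mulgA refl_sKr.
have szc : (size c).+1 = size a by rewrite sz eb /c !size_cat addnS.
rewrite big_cons (IHa (j :: c)) // big_cons.
have eb2 : wp b = (s j * (s i * wp (j :: c)))%g.
  by rewrite ec -word_prod_cons e word_prod_cons refl_sKl.
have IHb d : size d = size a -> wp d = wp b ->
    \prod_(i <- b) f i = \prod_(i <- d) f i.
  move=> szd ed; apply: IH => //; first by rewrite -sz.
  by move=> d'; rewrite szd ed sz; apply: rb'.
have [adj|nadj] := boolP (adjacent i j); last first.
  rewrite mulrA f_comm // -mulrA [in RHS]big_cons (IHb (i :: c)) //=.
    by rewrite big_cons.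
  rewrite eb2 !word_prod_cons; rewrite [(s i * (s j * _))%g]mulgA.
  by rewrite refl_s_comm // -!mulgA refl_sKl.
(* For adjacent letters a second exchange is made, of [s j] against [[:: i, j & c]]. The deleted
   letter is shown to be neither [i] nor [j], so it lies in [c], which leaves [d]. *)
have rijc : reduced [:: i, j & c].
  move=> d; rewrite word_prod_cons ec -word_prod_cons /= szc.
  exact: ra.
have := left_exchange rijc (_ : wp b = s j * _)%g.
rewrite word_prod_cons => /(_ eb2); rewrite /= szc -sz ltnS leqnn => /(_ isT).
rewrite !inE => /orP[/eqP/(refl_s_inj k_gt0) eij|].
  by rewrite eij eqxx in nij.
(* If [s j] were its own conjugate by [s i], the two generators would commute and the braid relation
   would force [s i = s j]. *)
case/orP=> [/eqP sjJ|].
  have : s j = s i; last first.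
    by move=> /(refl_s_inj k_gt0) eij; rewrite eij eqxx in nij.
  have := refl_s_braid adj; rewrite {1}sjJ conjgE refl_sV.
  rewrite !mulgA refl_sK mul1g refl_sKr -mulgA => /(congr1 ( *%g (s j))).
  by rewrite refl_sK refl_sKl => /esym h; rewrite -[LHS](refl_sKl i) h mulg1.
case/mapP => _ /mapP[v /reflections_exchange[c1 [m [c2 [ecm ecm']]]] ->] ev.
pose d := c1 ++ c2.
have szd : (size d).+1 = size c by rewrite ecm /d !size_cat addnS.
have ed : wp b = wp [:: i, j & d].
  rewrite eb2 !word_prod_cons /d ecm' {1}ev !conjgE !refl_sV.
  by rewrite !mulgA !refl_sKr.
have e3 : wp (j :: c) = wp [:: j, i & d].
  apply: (mulgI (s i)); rewrite ec.
  have -> : (s i * wp a)%g = wp (j :: b) by rewrite -word_prod_cons.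
  rewrite word_prod_cons ed !word_prod_cons.
  rewrite !mulgA; congr (_ * _)%g.
  by rewrite -!mulgA (refl_s_braid adj).
(* With [c] replaced by [i :: d] and [b] by [[:: i, j & d]], the two products differ only by a braid
   in front of [d]. *)
have -> : \prod_(i0 <- c) f i0 = \prod_(i0 <- i :: d) f i0.
  apply: IH; rewrite ?szd //; first by lia.
  - exact: (@reduced_catr [:: i; j]).
  - apply: (@reduced_catr [:: i; j]) => x ex; rewrite /= szd.
    have := rijc x; rewrite /=; apply; rewrite ex !(word_prod_cons i).
    by rewrite e3.
  - by apply: (mulgI (s j)); rewrite -!word_prod_cons e3.
rewrite [in RHS]big_cons (IHb [:: i, j & d]) ?big_cons /= ?szd ?szc //.
by rewrite !mulrA f_braid'.
Qed.

End Matsumoto.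

(** * Cyclically decreasing words *)

Section CyclicallyDecreasingWords.
Import mathcomp.boot.finset.
Variable k : nat.
Local Notation I := 'I_k.+1.
Local Notation word := (seq I).
Local Notation s := (@refl_s k).
Local Notation wp := (@word_prod k).
Implicit Types (a b : word) (i j m x : I) (A D : {set I}).

Lemma cyc_decreasingP D a : reflect
  [/\ uniq a, a =i D &
      forall j, j \in D -> ordS j \in D -> (index (ordS j) a < index j a)%N]
  (cyc_decreasing D a).
Proof.
apply: (iffP and3P) => [[ua /forallP aD h]|[ua aD h]]; split=> //.
- by move=> x; apply/eqP.
- by move=> j jD SjD; have /forall_inP/(_ j jD)/implyP/(_ SjD) := h.
- by apply/forallP => x; rewrite aD.
- by apply/forall_inP => j jD; apply/implyP; exact: h.
Qed.

Lemma word_prod_comm m a : all (fun x => ~~ adjacent m x) a ->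
  (s m * wp a = wp a * s m)%g.
Proof.
elim: a => [|x a IH] /=; first by rewrite word_prod_nil mulg1 mul1g.
case/andP => mx /IH e.
by rewrite word_prod_cons mulgA refl_s_comm // -!mulgA e.
Qed.

Lemma cyc_decreasing_remove D m a1 a2 : cyc_decreasing D (a1 ++ m :: a2) ->
  cyc_decreasing (D :\ m) (a1 ++ a2).
Proof.
move=> /cyc_decreasingP[ua aD aI].
have : perm_eq (a1 ++ m :: a2) (m :: (a1 ++ a2)).
  by rewrite -[m :: a2]cat1s perm_catCA.
move=> p; have := ua; rewrite (perm_uniq p) => /andP[ma ua'].
apply/cyc_decreasingP; split=> // [x|j].
  rewrite !inE -aD (perm_mem p) inE.
  by have [->|//] := eqVneq x m; rewrite (negbTE ma).
rewrite !inE => /andP[jm jD] /andP[Sjm SjD]; have := aI j jD SjD.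
rewrite !index_cat /= !(eq_sym m) (negbTE jm) (negbTE Sjm).
case: ifP => Sja; case: ifP => _; first by [].
- by move=> _; apply: ltn_addr; rewrite index_mem.
- lia.
- lia.
Qed.

(** The letters listed before [m] all commute with it: [m + 1] is absent, and [m - 1], if present,
    comes after [m]. *)
Lemma cyc_decreasing_first D m a : cyc_decreasing D a -> m \in D ->
  ordS m \notin D -> exists2 b, cyc_decreasing (D :\ m) b & wp a = (s m * wp b)%g.
Proof.
move=> aDec mD SmD; case/cyc_decreasingP: (aDec) => ua aD aI.
have := mD; rewrite -aD => /splitPr am.
case: am aDec ua aD aI => a1 a2 aDec ua aD aI.
exists (a1 ++ a2); first exact: cyc_decreasing_remove aDec.
rewrite !word_prod_cat word_prod_cons !mulgA word_prod_comm //.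
apply/allP => x xa; rewrite /adjacent negb_or.
have xD : x \in D by rewrite -aD mem_cat xa.
apply/andP; split; last by apply: contraNneq SmD => <-.
apply/negP => /eqP mE; have := aI x xD; rewrite -mE mD => /(_ isT).
have ma : m \notin a1.
  by move: ua; rewrite cat_uniq => /and3P[_ /hasPn/(_ m (mem_head _ _))].
rewrite !index_cat (negbTE ma) /= eqxx addn0 xa.
by rewrite ltnNge ltnW // index_mem.
Qed.

(** Mirror image: [m - 1] is absent and [m + 1] can only stand before [m], so [m] commutes to the
    right end. *)
Lemma cyc_decreasing_last D m a : cyc_decreasing D a -> m \in D ->
  ord_pred m \notin D ->
  exists2 b, cyc_decreasing (D :\ m) b & wp a = (wp b * s m)%g.
Proof.
move=> aDec mD SmD; case/cyc_decreasingP: (aDec) => ua aD aI.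
have := mD; rewrite -aD => /splitPr am.
case: am aDec ua aD aI => a1 a2 aDec ua aD aI.
exists (a1 ++ a2); first exact: cyc_decreasing_remove aDec.
rewrite !word_prod_cat word_prod_cons -!mulgA -word_prod_comm //.
apply/allP => x xa; rewrite /adjacent negb_or.
have xD : x \in D by rewrite -aD mem_cat inE xa !orbT.
apply/andP; split; first by apply: contraNneq SmD => ->; rewrite ordSK.
apply/negP => /eqP xE; have := aI m mD; rewrite -xE xD => /(_ isT).
move: ua; rewrite cat_uniq => /and3P[_ /hasPn nh _].
have xa1 : x \notin a1 by apply: nh; rewrite inE xa orbT.
have ma1 : m \notin a1 by apply: nh; rewrite mem_head.
by rewrite !index_cat (negbTE ma1) (negbTE xa1) /= eqxx; case: ifP; lia.
Qed.

(** If every predecessor stayed in [D], walking backwards from one element would reach the whole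
    cycle. *)
Lemma proper_set_boundary D : D != set0 -> D != setT ->
  exists2 m, m \in D & ord_pred m \notin D.
Proof.
case/set0Pn => x0 x0D /negP DT.
have [//|nex] := pselect (exists2 m, m \in D & ord_pred m \notin D).
case: DT; apply/eqP/setP => y; rewrite inE.
have h d : residue k (x0%:Z - d%:Z) \in D.
  elim: d => [|d IH]; first by rewrite subr0 residue_val.
  apply: contraT => nd; case: nex; exists (residue k (x0%:Z - d%:Z)) => //.
  move: nd; set z := residue k (_ - d.+1%:Z); set w := residue _ _.
  suff -> : ord_pred w = z by [].
  apply: (@ordS_inj k.+1); rewrite ord_predK /z /w ordS_residue.
  by congr residue; rewrite -[d.+1]addn1 PoszD; ring.
(* This number of backward steps leads from [x0] to [y - (k + 1)], which is [y] on the cycle; adding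
   the full period keeps the subtraction in [nat] exact. *)
have := h (x0 + (k.+1 - y))%N; congr (_ \in D).
rewrite -[RHS](residue_val y); apply/eqP/residueP; exists (-1).
by rewrite PoszD -(subzn (ltnW (ltn_ord y))); ring.
Qed.

(** A boundary element [m], with [m - 1] absent, may be appended last to a listing of the rest,
    since no letter has to come after it. *)
Lemma cyc_decreasing_exists D : D != setT -> exists a, cyc_decreasing D a.
Proof.
elim: {D}#|D| {-2}D (erefl #|D|) => [|n IH] D cD DT.
  exists [::]; move/eqP: cD; rewrite cards_eq0 => /eqP->.
  by apply/cyc_decreasingP; split=> // [x|j]; rewrite !inE.
have D0 : D != set0 by rewrite -card_gt0 cD.
have [m mD pmD] := proper_set_boundary D0 DT.
have DmT : D :\ m != setT.
  by apply/eqP => /setP/(_ m); rewrite !inE eqxx.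
have cDm : #|D :\ m| = n by move: cD; rewrite (cardsD1 m) mD add1n => -[].
have [a /cyc_decreasingP[ua aD aI]] := IH _ cDm DmT.
have ma : m \notin a by rewrite aD !inE eqxx.
exists (rcons a m); apply/cyc_decreasingP; split.
- by rewrite rcons_uniq ma.
- by move=> x; rewrite mem_rcons inE aD !inE; case: eqP => // ->.
move=> j jD SjD; rewrite -cats1 !index_cat.
have Sjm : ordS j != m by apply: contraNneq pmD => <-; rewrite ordSK.
have Sja : ordS j \in a by rewrite aD !inE Sjm.
rewrite Sja; case: ifP => ja; last by rewrite ltn_addr // index_mem.
by apply: aI => //; rewrite -aD.
Qed.

(** The same boundary letter can be split off at the right end of both listings. *)
Lemma cyc_decreasing_unique D a b : D != setT ->
  cyc_decreasing D a -> cyc_decreasing D b -> wp a = wp b.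
Proof.
elim: {D}#|D| {-2}D (erefl #|D|) a b => [|n IH] D cD a b DT aD bD.
  have nil c : cyc_decreasing D c -> c = [::].
    case/cyc_decreasingP => _ cE _; case: c cE => // x c /(_ x).
    by rewrite mem_head (cards0_eq cD) inE.
  by rewrite (nil _ aD) (nil _ bD).
have D0 : D != set0 by rewrite -card_gt0 cD.
have [m mD pmD] := proper_set_boundary D0 DT.
have DmT : D :\ m != setT.
  by apply/eqP => /setP/(_ m); rewrite !inE eqxx.
have cDm : #|D :\ m| = n by move: cD; rewrite (cardsD1 m) mD add1n => -[].
have [a' a'D ->] := cyc_decreasing_last aD mD pmD.
have [b' b'D ->] := cyc_decreasing_last bD mD pmD.
by rewrite (IH _ cDm _ _ DmT a'D b'D).
Qed.

(** The listing used by [u_set], kept as a word so that it can be evaluated both in W and in the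
    nilCoxeter algebra. *)
Definition cyc_word D : word :=
  head [::] [seq a <- permutations (enum D) | cyc_decreasing D a].

Lemma cyc_wordP D : D != setT -> cyc_decreasing D (cyc_word D).
Proof.
move=> DT; rewrite /cyc_word; set l := filter _ _.
suff : l != [::].
  rewrite -/(nilp l) => h.
  have : head [::] l \in l by case: (l) h => //= *; rewrite mem_head.
  by rewrite mem_filter => /andP[].
have [a aDec] := cyc_decreasing_exists DT.
case/cyc_decreasingP: (aDec) => ua aD _.
suff : a \in l by case: (l).
rewrite mem_filter aDec mem_permutations; apply: uniq_perm => //.
  exact: enum_uniq.
by move=> x; rewrite mem_enum aD.
Qed.

Lemma cyc_word_last D m : m \in D -> ord_pred m \notin D ->
  wp (cyc_word D) = (wp (cyc_word (D :\ m)) * s m)%g.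
Proof.
move=> mD pmD.
have DT : D != setT by apply: contraNneq pmD => ->; rewrite inE.
have DmT : D :\ m != setT.
  by apply/eqP => /setP/(_ m); rewrite !inE eqxx.
have [b bD ->] := cyc_decreasing_last (cyc_wordP DT) mD pmD.
by rewrite (cyc_decreasing_unique DmT bD (cyc_wordP DmT)).
Qed.

Lemma cyc_word_first D m : m \in D -> ordS m \notin D ->
  wp (cyc_word D) = (s m * wp (cyc_word (D :\ m)))%g.
Proof.
move=> mD pmD.
have DT : D != setT by apply: contraNneq pmD => ->; rewrite inE.
have DmT : D :\ m != setT.
  by apply/eqP => /setP/(_ m); rewrite !inE eqxx.
have [b bD ->] := cyc_decreasing_first (cyc_wordP DT) mD pmD.
by rewrite (cyc_decreasing_unique DmT bD (cyc_wordP DmT)).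
Qed.

Lemma mem_shift_set A d (z : int) :
  (residue k z \in shift_set A d) = (residue k (z - d%:Z) \in A).
Proof.
have inZpE (x : I) : inZp (x + d) = residue k (x%:Z + d%:Z) :> I.
  by apply: val_inj; rewrite /residue /= -PoszD modz_nat absz_nat modn_mod.
apply/imsetP/idP => [[x xA]|zA].
  rewrite inZpE => /eqP/residueP[q e].
  suff -> : residue k (z - d%:Z) = x by [].
  by rewrite -[RHS]residue_val; apply/eqP/residueP; exists q; rewrite e; ring.
exists (residue k (z - d%:Z)) => //; rewrite inZpE.
have /eqP/residueP[q e] := residue_val (residue k (z - d%:Z)).
apply/eqP/residueP; exists (- q); rewrite e; ring.
Qed.

Lemma card_shift_set A d : #|shift_set A d| = #|A|.
Proof.
apply: card_imset => x y /(congr1 val) /= /eqP e.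
by apply/val_inj/eqP; move: e; rewrite eqn_modDr !modn_small.
Qed.

Lemma shift_set0 A : shift_set A 0 = A.
Proof. by apply/setP => x; rewrite -(residue_val x) mem_shift_set subr0. Qed.

Lemma mem_shift_setS A d x :
  (x \in shift_set A d.+1) = (ord_pred x \in shift_set A d).
Proof.
rewrite -[x]ord_predK -(residue_val (ord_pred x)) ordS_residue !mem_shift_set.
rewrite -ordS_residue residue_val ord_predK -[in RHS](residue_val (ord_pred x)).
by rewrite mem_shift_set -[d.+1]addn1 PoszD; congr (residue _ _ \in A); ring.
Qed.

Definition v_word r A : word :=
  flatten [seq cyc_word (shift_set A d) | d <- iota 0 r].

Hypothesis k_gt0 : (0 < k)%N.

(* Each letter of a makes the particle at its site hop, because the site in
   front is empty or has just been vacated. *)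
Lemma disp_move_decreasing a (S : pred I) : uniq a ->
    (forall x, x \in a -> S x) ->
    (forall x, x \in a -> S (ordS x) -> (index (ordS x) a < index x a)%N) ->
  disp a S = size a /\
  move a S =1 fun y => S y && (y \notin a) || (ord_pred y \in a).
Proof.
elim: a S => [|h a IH] S; first by split=> // y; rewrite /= andbT orbF.
rewrite cons_uniq => /andP[ha ua] aS aI.
have Sh : S h by rewrite aS ?mem_head.
have nSh : S (ordS h) = false.
  by apply/negP => /(aI h (mem_head _ _)); rewrite /= eqxx ltn0.
have nha : ordS h \notin a.
  by apply/negP => hin; have := aS (ordS h); rewrite nSh inE hin orbT => /(_ isT).
have swE y : swap_site h S y = (y == ordS h) || (y != h) && S y.
  rewrite /swap_site /=; have [->|yh] := eqVneq y h.
    by rewrite tpermL nSh eq_sym (negbTE (ordS_neq k_gt0 h)).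
  have [->|ySh] := eqVneq y (ordS h); first by rewrite tpermR Sh.
  by rewrite tpermD // eq_sym.
have [||dE mE] := IH (swap_site h S) ua.
- move=> x xa; rewrite swE aS ?inE ?xa ?orbT // andbT.
  by rewrite [x != h](memPn ha) ?orbT.
- move=> x xa; rewrite swE.
  have xh : x != h by exact: (memPn ha).
  rewrite (inj_eq (@ordS_inj _)) (negbTE xh) /= => /andP[Sxh SSx].
  have := aI x; rewrite inE xa orbT => /(_ isT SSx) /=.
  by rewrite (eq_sym h) (negbTE Sxh) (eq_sym h) (negbTE xh) ltnS.
split=> [|y]; rewrite /= -/(move _ _).
  by rewrite dE Sh nSh -[(size a).+1]addn1 PoszD addrC subr0.
rewrite mE swE !inE negb_or.
have -> : (ord_pred y == h) = (y == ordS h).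
  by apply/eqP/eqP => [<-|->]; rewrite ?ord_predK ?ordSK.
have [->|ySh] := eqVneq y (ordS h); first by rewrite nha /= orbT.
by rewrite /=; case: (S y); case: (y == h); rewrite ?andbF.
Qed.

(** The factor of shift [d] carries the particles from [A + d] to [A + d + 1], one hop each. *)
Lemma disp_v_word r A : A != setT -> disp (v_word r A) (mem A) = (r * #|A|)%:Z.
Proof.
move=> AT; rewrite /v_word -{2}[A]shift_set0.
elim: r 0%N => [|r IH] d //=; rewrite disp_cat.
have ST : shift_set A d != setT.
  apply: contra_neq AT => e; apply/eqP; rewrite eqEcard subsetT.
  by rewrite -(card_shift_set A d) e /=.
have /cyc_decreasingP[ua aD aI] := cyc_wordP ST.
have [||-> mE] := @disp_move_decreasing _ (mem (shift_set A d)) ua.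
- by move=> x; rewrite aD.
- by move=> x; rewrite aD; exact: aI.
have -> : move (cyc_word (shift_set A d)) (mem (shift_set A d)) =
          mem (shift_set A d.+1) :> pred I.
  apply/funext => y; rewrite mE aD /= mem_shift_setS aD.
  by case: (y \in _).
rewrite IH -PoszD mulSn; congr (_ + _)%:Z.
rewrite -(card_shift_set A d) -(card_uniqP ua).
by apply: eq_card.
Qed.

Lemma reduced_v_word c r A : (c + r)%N = k.+1 -> (0 < c)%N -> (0 < r)%N ->
  #|A| = c -> reduced (v_word r A).
Proof.
move=> cr c0 r0 cA b /word_prod_eqP/(cox_cong_disp k_gt0)/(_ (mem A))[_].
have AT : A != setT.
  by apply/eqP => AT; move: cA; rewrite AT cardsT card_ord; lia.
have sz : size (v_word r A) = (r * c)%N.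
  rewrite size_flatten /shape -map_comp -cA.
  have szd d : size (cyc_word (shift_set A d)) = #|A|.
    have ST : shift_set A d != setT.
      apply: contra_neq AT => e; apply/eqP; rewrite eqEcard subsetT.
      by rewrite -(card_shift_set A d) e /=.
    have /cyc_decreasingP[ua aD _] := cyc_wordP ST.
    rewrite -(card_shift_set A d) -(card_uniqP ua).
    by apply: eq_card.
  by elim: r 0%N {cr r0} => //= r IH d; rewrite szd IH mulSn.
(* For [k = 1] the displacement is known only modulo 6, but then [c = r = 1] and it suffices that
   the empty word has displacement 0, not 1. Otherwise [disp_le] bounds the length of [b]. *)
rewrite disp_v_word // sz cA /disp_mod; case: ifP => [/eqP k1|_].
  have -> : c = 1%N by lia.
  have -> : r = 1%N by lia.
  by case: b.
by rewrite !modz0 => e; have := disp_le b (mem A); rewrite e; lia.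
Qed.

End CyclicallyDecreasingWords.

(** * Replacing one element of [A] by its predecessor in the shifted product *)

Section ShiftedWords.
Import mathcomp.boot.finset.
Variable k : nat.
Local Notation s := (@refl_s k).
Local Notation wp := (@word_prod k).
Local Notation res := (residue k).

(** The factor of [A + d] ends in [s_{z+d}], that of [A' + d] starts with [s_{z-1+d}], and what
    remains of both is equal. A letter [s_{z-1+d}] entering on the left thus leaves on the right as
    [s_{z+d}], exactly what the next factor needs. *)
Lemma v_word_shift_step r (A A' : {set 'I_k.+1}) (z : int) :
    res z \in A -> res (z - 1) \notin A -> res z \notin A' -> res (z - 1) \in A' ->
    (forall x, x != res z -> x != res (z - 1) -> (x \in A) = (x \in A')) ->
  (s (res (z - 1)) * wp (v_word r A) = wp (v_word r A') * s (res (z - 1 + r%:Z)))%g.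
Proof.
move=> zA z1A zA' z1A' AA'.
have nz : res z != res (z - 1) by apply: contraNneq z1A => <-.
(* The first shift is generalized from 0 to [d] for the induction on the number of factors. *)
suff h d :
    (s (res (z - 1 + d%:Z)) *
       wp (flatten [seq cyc_word (shift_set A i) | i <- iota d r]) =
     wp (flatten [seq cyc_word (shift_set A' i) | i <- iota d r]) *
       s (res (z - 1 + d%:Z + r%:Z)))%g.
  by have := h 0%N; rewrite addr0.
elim: r d => [|t IH] d /=; first by rewrite word_prod_nil mulg1 mul1g addr0.
rewrite !word_prod_cat.
have mE : ord_pred (res (z + d%:Z)) = res (z - 1 + d%:Z).
  apply: (@ordS_inj k.+1); rewrite ord_predK ordS_residue.
  by congr residue; ring.
rewrite (@cyc_word_last _ (shift_set A d) (res (z + d%:Z))); first last.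
- by rewrite mE mem_shift_set addrK.
- by rewrite mem_shift_set addrK.
rewrite (@cyc_word_first _ (shift_set A' d) (res (z - 1 + d%:Z))); first last.
- by rewrite -mE ord_predK mem_shift_set addrK.
- by rewrite mem_shift_set addrK.
have -> : shift_set A' d :\ res (z - 1 + d%:Z) = shift_set A d :\ res (z + d%:Z).
  apply/setP => x; rewrite -(residue_val x) !inE !mem_shift_set.
  have eqE y : (res x == res (y + d%:Z)) = (res (x%:Z - d%:Z) == res y).
    apply/residueP/residueP => -[q e]; exists q;
      last by rewrite -[LHS](subrK d%:Z) e; ring.
    by rewrite e; ring.
  rewrite !eqE; have [->|n1] := eqVneq (res (x%:Z - d%:Z)) (res (z - 1)).
    by rewrite (negbTE z1A) andbF.
  have [->|n2] := eqVneq (res (x%:Z - d%:Z)) (res z); first by rewrite (negbTE zA').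
  by rewrite AA'.
rewrite -!mulgA; do 2 congr (_ * _)%g.
have := IH d.+1.
have -> : z - 1 + d.+1%:Z = z + d%:Z by rewrite -[d.+1]addn1 PoszD; ring.
have -> : z + d%:Z + t%:Z = z - 1 + d%:Z + t.+1%:Z.
  by rewrite -[t.+1]addn1 PoszD; ring.
exact.
Qed.

End ShiftedWords.

(** * Skew shapes *)

Section SkewShapes.
Import mathcomp.boot.finset.
Variables k c r : nat.
Local Notation I := 'I_k.+1.
Local Notation word := (seq I).
Local Notation s := (@refl_s k).
Local Notation wp := (@word_prod k).
Local Notation res := (residue k).
Implicit Types (A : {set I}) (f : nat -> nat).

Definition row_prod (i a b : nat) : affW k :=
  wp [seq res (j%:Z - i%:Z) | j : nat <- rev (iota a (b - a))].

(** The first product is the copy of [nu] below [R], in rows [r] to [2r - 1]; the second is [R/nu].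
    Parts are a function padded with zeros, so that adding a cell is a pointwise change. *)
Definition skew_prod f : affW k :=
  ((\prod_(p <- rev (iota 0 r)) row_prod (r + p) 0 (f p)) *
   (\prod_(p <- rev (iota 0 r)) row_prod p (f p) c))%g.

Lemma row_prod_recr i a b : (a < b)%N ->
  row_prod i a b = (row_prod i a.+1 b * s (res (a%:Z - i%:Z)))%g.
Proof.
move=> ab; rewrite /row_prod -(subnSK ab) /= rev_cons map_rcons -cats1.
by rewrite word_prod_cat word_prod_cons word_prod_nil mulg1.
Qed.

Lemma row_prod_recl i b :
  row_prod i 0 b.+1 = (s (res (b%:Z - i%:Z)) * row_prod i 0 b)%g.
Proof.
by rewrite /row_prod !subn0 -[b.+1]addn1 iotaD rev_cat /= word_prod_cons.
Qed.

Lemma row_prod_comm (x : int) (i a b : nat) :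
    (forall j, (a <= j < b)%N -> ~~ adjacent (res x) (res (j%:Z - i%:Z))) ->
  (s (res x) * row_prod i a b = row_prod i a b * s (res x))%g.
Proof.
move=> h; apply: word_prod_comm; apply/allP => y /mapP[j].
rewrite mem_rev mem_iota => hj ->; apply: h; move: hj.
by case: (leqP a b) => ab; lia.
Qed.

Lemma commute_prod_seq (x : affW k) (l : seq nat) (F : nat -> affW k) :
    (forall i, i \in l -> x * F i = F i * x)%g ->
  (x * \prod_(i <- l) F i = (\prod_(i <- l) F i) * x)%g.
Proof.
elim: l => [|i l IH] h; first by rewrite big_nil mulg1 mul1g.
rewrite !big_cons mulgA h ?mem_head // -!mulgA IH // => j jl.
by apply: h; rewrite inE jl orbT.
Qed.

Definition in_rect f :=
  [/\ forall i j, (i <= j)%N -> (f j <= f i)%N, (f 0 <= c)%N & f r = 0%N].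

Lemma in_rect_le f i : in_rect f -> (f i <= c)%N.
Proof. by case=> mono f0 _; apply: leq_trans (mono 0%N i _) f0. Qed.

Lemma in_rect0 f i : in_rect f -> (r <= i)%N -> f i = 0%N.
Proof. by case=> mono _ fr ri; have := mono _ _ ri; lia. Qed.

Definition add_box p f : nat -> nat := fun i => (f i + (i == p))%N.

Lemma big_rev_iota_split p (F : nat -> affW k) : (p < r)%N ->
  (\prod_(i <- rev (iota 0 r)) F i =
   (\prod_(i <- rev (iota p.+1 (r - p.+1))) F i) *
   (F p * \prod_(i <- rev (iota 0 p)) F i))%g.
Proof.
move=> pr; have -> : iota 0 r = iota 0 p ++ p :: iota p.+1 (r - p.+1).
  by rewrite -{1}(subnKC (ltnW pr)) iotaD add0n -(subnSK pr).
by rewrite rev_cat rev_cons -cats1 !big_cat /= big_seq1 mulgA.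
Qed.

(** The content of the cell just to the right of row [r + p], the row of the lower copy of [nu] that
    has length [f p]. *)
Definition lattice_step f (p : nat) : int := (f p)%:Z - p%:Z - r%:Z.

(* The complement of phi(nu): the vertical steps of the boundary path. *)
Definition step_set f : {set I} := [set res (lattice_step f p) | p : 'I_r].

Lemma step_setP f x : reflect
  (exists2 p : nat, (p < r)%N & x = res (lattice_step f p)) (x \in step_set f).
Proof.
apply: (iffP imsetP) => [[p _ ->]|[p pr ->]]; first by exists p.
by exists (Ordinal pr).
Qed.

Lemma lattice_step_mono f p q : in_rect f -> (p < q)%N ->
  lattice_step f q < lattice_step f p.
Proof.
by case=> mono _ _ pq; have := mono _ _ (ltnW pq); rewrite /lattice_step; lia.
Qed.

Hypothesis cr : (c + r)%N = k.+1.

(* The contents read to the right of the removed cell and to the left of the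
   added one stay at distance at least 2 and less than k from its content, so
   that both letters commute to the ends of the word. *)
Lemma skew_prod_add_box p f : (p < r)%N -> in_rect f -> in_rect (add_box p f) ->
  skew_prod (add_box p f) =
  (s (res ((f p)%:Z - p%:Z - r%:Z)) * skew_prod f * s (res ((f p)%:Z - p%:Z)))%g.
Proof.
move=> pr fR gR; rewrite /skew_prod.
have fpc : (f p < c)%N by have := in_rect_le p gR; rewrite /add_box eqxx; lia.
have big_eq (F G : nat -> affW k) (l : seq nat) : (forall i, i \in l -> F i = G i) ->
    (\prod_(i <- l) F i = \prod_(i <- l) G i)%g.
  by move=> h; rewrite big_seq [RHS]big_seq; exact: eq_bigr.
have lower : (\prod_(i <- rev (iota 0 r)) row_prod (r + i) 0 (add_box p f i) =
    s (res ((f p)%:Z - p%:Z - r%:Z)) *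
    \prod_(i <- rev (iota 0 r)) row_prod (r + i) 0 (f i))%g.
  rewrite !(big_rev_iota_split _ pr) [in RHS]mulgA.
  rewrite (@commute_prod_seq (s (res ((f p)%:Z - p%:Z - r%:Z)))) => [|i].
    rewrite -!mulgA; congr (_ * _)%g.
      apply: big_eq => i; rewrite mem_rev mem_iota => hi.
      by rewrite /add_box; case: eqP => [|_]; [lia | rewrite addn0].
    rewrite !mulgA; congr (_ * _)%g.
      rewrite /add_box eqxx addn1 row_prod_recl; congr (s (res _) * _)%g.
      by rewrite PoszD; ring.
    apply: big_eq => i; rewrite mem_rev mem_iota => hi.
    by rewrite /add_box; case: eqP => [|_]; [lia | rewrite addn0].
  rewrite mem_rev mem_iota => hi; apply: row_prod_comm => j hj.
  have : (f i <= f p)%N by case: fR => mono _ _; apply: mono; lia.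
  rewrite adjacentC => h; apply: nonadjacent_residue; rewrite PoszD; lia.
have upper : (\prod_(i <- rev (iota 0 r)) row_prod i (f i) c =
    (\prod_(i <- rev (iota 0 r)) row_prod i (add_box p f i) c) *
    s (res ((f p)%:Z - p%:Z)))%g.
  rewrite !(big_rev_iota_split _ pr) -!mulgA.
  rewrite -(@commute_prod_seq (s (res ((f p)%:Z - p%:Z)))) => [|i].
    congr (_ * _)%g.
      apply: big_eq => i; rewrite mem_rev mem_iota => hi.
      by rewrite /add_box; case: eqP => [|_]; [lia | rewrite addn0].
    rewrite !mulgA; congr (_ * _)%g.
      by rewrite /add_box eqxx addn1 row_prod_recr.
    apply: big_eq => i; rewrite mem_rev mem_iota => hi.
    by rewrite /add_box; case: eqP => [|_]; [lia | rewrite addn0].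
  rewrite mem_rev mem_iota => hi; apply: row_prod_comm => j hj.
  have : (f p < add_box p f i)%N.
    case: gR => mono _ _; have := mono i p; rewrite /add_box eqxx; lia.
  move=> h; apply: nonadjacent_residue; lia.
by rewrite lower upper -!mulgA refl_sK mulg1.
Qed.

Lemma lattice_step_window f p : in_rect f -> (p < r)%N ->
  1 - 2 * r%:Z <= lattice_step f p < 1 - 2 * r%:Z + k.+1%:Z.
Proof.
by move=> fR pr; have := in_rect_le p fR; rewrite /lattice_step -cr; lia.
Qed.

Lemma lattice_step_inj f p q : in_rect f -> (p < r)%N -> (q < r)%N ->
  res (lattice_step f p) = res (lattice_step f q) -> p = q.
Proof.
move=> fR pr qr /residue_inj_window e.
have {}e := e _ (lattice_step_window fR pr) (lattice_step_window fR qr).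
by case: (ltngtP p q) => // /(lattice_step_mono fR); rewrite e; lia.
Qed.

(** The new cell raises the step [z - 1] of row [p] to [z], so the complement trades [z] for
    [z - 1], the situation of [v_word_shift_step]. *)
Lemma v_word_add_box p f : (p < r)%N -> in_rect f -> in_rect (add_box p f) ->
  wp (v_word r (~: step_set (add_box p f))) =
  (s (res ((f p)%:Z - p%:Z - r%:Z)) * wp (v_word r (~: step_set f)) *
   s (res ((f p)%:Z - p%:Z)))%g.
Proof.
move=> pr fR gR; set z := lattice_step f p + 1.
have zE : lattice_step (add_box p f) p = z.
  by rewrite /z /lattice_step /add_box eqxx; lia.
have stepE i : i != p -> lattice_step (add_box p f) i = lattice_step f i.
  by move=> ip; rewrite /lattice_step /add_box (negbTE ip) addn0.
have z1E : z - 1 = lattice_step f p by rewrite /z addrK.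
have zn1 : res z != res (z - 1).
  apply/eqP => /residue_inj_window e.
  have wz := lattice_step_window gR pr; rewrite zE in wz.
  have wz1 := lattice_step_window fR pr; rewrite -z1E in wz1.
  by have := e _ wz wz1; lia.
have zf : res z \notin step_set f.
  apply/negP => /step_setP[i ir]; have [->|ip] := eqVneq i p.
    by rewrite -z1E => /eqP; rewrite (negbTE zn1).
  rewrite -zE -stepE // => /esym/(lattice_step_inj gR ir pr) e.
  by rewrite e eqxx in ip.
have z1g : res (z - 1) \notin step_set (add_box p f).
  apply/negP => /step_setP[i ir]; have [->|ip] := eqVneq i p.
    by rewrite zE => /esym/eqP; rewrite (negbTE zn1).
  rewrite z1E stepE // => /esym/(lattice_step_inj fR ir pr) e.
  by rewrite e eqxx in ip.
have := @v_word_shift_step k r (~: step_set f) (~: step_set (add_box p f)) z.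
rewrite !in_setC !negbK zf z1g => /(_ isT) key.
have zE1 : z - 1 + r%:Z = (f p)%:Z - p%:Z by rewrite z1E /lattice_step; ring.
rewrite -/(lattice_step f p) -z1E -zE1 key ?refl_sKr //.
- by apply/step_setP; exists p; rewrite ?z1E.
- by apply/step_setP; exists p; rewrite ?zE.
move=> x xz xz1; rewrite !in_setC; congr (~~ _).
apply/step_setP/step_setP => -[i ir xE]; exists i => //; rewrite xE.
  by rewrite stepE //; apply: contra_neq xz1 => ip; rewrite xE ip z1E.
by rewrite stepE //; apply: contra_neq xz => ip; rewrite xE ip zE.
Qed.

Hypothesis r_gt0 : (0 < r)%N.

(** For the empty partition the complement consists of the residues of [1 - r, ..., c - r]; its
    shift by [d] gives the contents of row [r - 1 - d] of the rectangle, which decrease by 1 when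
    read right to left. *)
Lemma row_word_cyc_decreasing d : (d < r)%N ->
  cyc_decreasing (shift_set (~: step_set (fun=> 0%N)) d)
    [seq res (j%:Z - (r.-1 - d)%:Z) | j : nat <- rev (iota 0 c)].
Proof.
move=> dr; set i := (r.-1 - d)%N; set h := fun j : nat => res (j%:Z - i%:Z).
have hinj x y : (x <= c)%N -> (y <= c)%N -> h x = h y -> x = y.
  move=> xc yc /(residue_inj_window (a := - i%:Z)) e.
  have : x%:Z - i%:Z = y%:Z - i%:Z by apply: e; lia.
  lia.
have ua : uniq [seq h j | j <- rev (iota 0 c)].
  rewrite map_inj_in_uniq ?rev_uniq ?iota_uniq // => x y.
  by rewrite !mem_rev !mem_iota => xc yc; apply: hinj; lia.
have idx x : (x < c)%N -> index (h x) [seq h j | j <- rev (iota 0 c)] = (c - x.+1)%N.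
  move=> xc; have szc : (c - x.+1 < size [seq h j | j <- rev (iota 0 c)])%N.
    by rewrite size_map size_rev size_iota; lia.
  rewrite -[RHS](index_uniq (h 0%N) szc ua) (nth_map 0%N);
    last by rewrite -(size_map h).
  by rewrite nth_rev size_iota ?nth_iota; first (congr (index (h _) _)); lia.
have memE (y : int) : - i%:Z <= y < - i%:Z + k.+1%:Z ->
    (res y \in shift_set (~: step_set (fun=> 0%N)) d) = (y < c%:Z - i%:Z).
  move=> yw; rewrite mem_shift_set in_setC.
  have id : i%:Z = r%:Z - 1 - d%:Z by rewrite /i; lia.
  apply/idP/idP => [|yc].
    (* The step of row [p] is [- p - r]; one period [c + r] above it lies [c - p], whence the
       witness. *)
    apply: contraR => yc; apply/step_setP; exists (absz (c%:Z - (y - d%:Z))%R).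
      by lia.
    apply/eqP/residueP; exists 1; rewrite /lattice_step mul1r -cr; lia.
  apply/step_setP => -[p pr /eqP/residueP[q]]; rewrite /lattice_step => e.
  apply: (@no_small_multiple k (c%:Z - p%:Z - (y - d%:Z)) (1 - q)).
    by rewrite -cr; lia.
  rewrite e mulrBl mul1r -cr PoszD; ring.
apply/cyc_decreasingP; split=> // [x|j jD SjD].
  have [y yw ->] := residue_surj (- i%:Z) x; rewrite memE //.
  apply/mapP/idP => [[j]|yc].
    rewrite mem_rev mem_iota => jc.
    move=> /(residue_inj_window (a := - i%:Z)) e.
    by have := e yw; rewrite -cr => {}e; lia.
  exists (absz (y + i%:Z)%R); first by rewrite mem_rev mem_iota; lia.
  by congr residue; lia.
have [y yw jE] := residue_surj (- i%:Z) j.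
have [y' yw' SjE] := residue_surj (- i%:Z) (ordS j).
move: jD SjD; rewrite jE memE // ordS_residue => yc.
have yw1 : - i%:Z <= y + 1 < - i%:Z + k.+1%:Z by rewrite -cr; lia.
rewrite memE // => yc1.
have -> : res y = h (absz (y + i%:Z)%R) by congr residue; lia.
have -> : res (y + 1) = h (absz (y + 1 + i%:Z)%R) by congr residue; lia.
by rewrite !idx; lia.
Qed.

Lemma skew_prod_rect : skew_prod (fun=> 0%N) = wp (v_word r (~: step_set (fun=> 0%N))).
Proof.
rewrite /skew_prod big1 ?mul1g => [|p _]; last first.
  by rewrite /row_prod /= word_prod_nil.
have -> : rev (iota 0 r) = [seq (r.-1 - d)%N | d <- iota 0 r].
  apply: (@eq_from_nth _ 0%N) => [|i]; first by rewrite size_rev size_map.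
  rewrite size_rev size_iota => ir.
  by rewrite nth_rev ?size_iota // (nth_map 0%N) ?size_iota // !nth_iota; lia.
rewrite /v_word /word_prod big_flatten !big_map /=.
rewrite big_seq [RHS]big_seq; apply: eq_bigr => d; rewrite mem_iota => /= dr.
rewrite /row_prod subn0 -/(word_prod _).
have dec := row_word_cyc_decreasing dr.
suff DT : shift_set (~: step_set (fun=> 0%N)) d != setT.
  exact: cyc_decreasing_unique DT dec (cyc_wordP DT).
apply/eqP => DT; case/cyc_decreasingP: dec => /card_uniqP ca aD _.
move: ca; rewrite (eq_card aD) DT cardsT card_ord size_map size_rev size_iota.
by rewrite -cr; lia.
Qed.

Lemma skew_prod_v_word f : in_rect f ->
  skew_prod f = wp (v_word r (~: step_set f)).
Proof.
elim: {f}(\sum_(i < r) f i)%N {-2}f (erefl (\sum_(i < r) f i)%N) => [|N IH] f sf fR.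
  have f0 i : f i = 0%N.
    have [ri|ir] := leqP r i; first exact: in_rect0.
    move/eqP: sf; rewrite sum_nat_eq0 => /forallP/(_ (Ordinal ir)) /=.
    by move/eqP.
  have -> : f = fun=> 0%N by apply/funext.
  exact: skew_prod_rect.
have [p0 p0r fp0] : exists2 p, (p < r)%N & (0 < f p)%N.
  have : (0 < \sum_(i < r) f i)%N by rewrite sf.
  rewrite lt0n sum_nat_eq0 => /forallPn[i]; rewrite -lt0n => fi.
  by exists i.
have ub q : (q < r)%N && (0 < f q)%N -> (q <= r)%N by case/andP => /ltnW.
have exq : exists q, (q < r)%N && (0 < f q)%N by exists p0; rewrite p0r.
(* The last cell of the last nonempty row is a corner, so removing it leaves a partition. *)
case: (ex_maxnP exq ub) => p /andP[pr fp] pmax.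
pose g i := (f i - (i == p))%N.
have gE : add_box p g = f.
  apply/funext => i; rewrite /add_box /g.
  by case: eqP => [->|_]; rewrite ?subnK ?subn0 ?addn0.
have gR : in_rect g.
  case: (fR) => mono f0 fr; split.
  - move=> i j ij; rewrite /g; have := mono i j ij.
    have [jp|jp] := leqP j p.
      by case: (i =P p) => ip; case: (j =P p) => jp' h; rewrite ?subn0 ?subn1; lia.
    have [jr|jr] := leqP r j; first by rewrite (in_rect0 fR jr); lia.
    have := pmax j; rewrite jr /=; lia.
  - by rewrite /g; lia.
  - by rewrite /g fr.
have sg : (\sum_(i < r) g i)%N = N.
  apply: succn_inj; rewrite -sf -gE [RHS](bigD1 (Ordinal pr)) //=.
  rewrite (bigD1 (Ordinal pr)) //= /add_box eqxx addn1 addSn; congr (_ + _).+1.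
  apply: eq_bigr => i ip; suff -> : (i == p :> nat) = false by rewrite addn0.
  by apply: contraNF ip => /eqP ip; apply/eqP/val_inj.
have fR' : in_rect (add_box p g) by rewrite gE.
by rewrite -gE skew_prod_add_box // v_word_add_box // IH.
Qed.

End SkewShapes.

(** * The bijection phi *)

Section PartitionsInRectangle.
Import mathcomp.boot.finset.
Variables k c r : nat.
Hypothesis r_gt0 : (0 < r)%N.
Local Notation I := 'I_k.+1.
Local Notation res := (residue k).
Local Notation in_rect := (in_rect c r).
Local Notation steps f := (step_set k r f).
Implicit Types (A : {set I}) (f g : nat -> nat) (nu : seq nat).

Lemma partition_in_rect nu : is_partition nu -> part_incl nu (rect c r) ->
  in_rect (nth 0%N nu).
Proof.
move=> /andP[snu _] inc; split.
- move=> i j ij; have [sj|js] := leqP (size nu) j; first by rewrite nth_default.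
  have geq_trans : transitive geq by move=> x y z /= xy yz; exact: leq_trans yz xy.
  apply: (sorted_leq_nth geq_trans (fun x => leqnn x) 0%N snu) => //.
  exact: leq_ltn_trans ij js.
- by have := inc 0%N; rewrite nth_nseq r_gt0.
- by have := inc r; rewrite nth_nseq ltnn; lia.
Qed.

Lemma size_partition_in_rect nu : is_partition nu -> part_incl nu (rect c r) ->
  (size nu <= r)%N.
Proof.
move=> /andP[_ nz] inc; rewrite leqNgt; apply/negP => rs.
have := inc r; rewrite nth_nseq ltnn leqn0 => /eqP e.
by move/negP: nz; apply; rewrite -e mem_nth.
Qed.

Lemma eq_partition nu mu : is_partition nu -> is_partition mu ->
  nth 0%N nu =1 nth 0%N mu -> nu = mu.
Proof.
have szP (la : seq nat) i : is_partition la -> (i < size la)%N = (nth 0%N la i != 0%N).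
  case/andP => _ nz; have [il|li] := ltnP i (size la).
    by rewrite (memPn nz) // mem_nth.
  by rewrite nth_default.
move=> pnu pmu e; apply: (@eq_from_nth _ 0%N) => //.
have h i : (i < size nu)%N = (i < size mu)%N by rewrite !szP // e.
have hm := h (size mu); have hn := h (size nu); rewrite !ltnn in hm hn.
by apply/eqP; rewrite eqn_leq leqNgt hm leqNgt -hn.
Qed.

Lemma in_rect_partition f : in_rect f ->
  exists nu, [/\ is_partition nu, part_incl nu (rect c r) & nth 0%N nu =1 f].
Proof.
move=> fR; have [mono f0 fr] := fR.
have ex0 : exists i, f i == 0%N by exists r; rewrite fr.
case: (ex_minnP ex0) => m /eqP fm mmin.
have nuE : nth 0%N (mkseq f m) =1 f.
  move=> i; have [im|mi] := ltnP i m; first by rewrite nth_mkseq.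
  by rewrite nth_default ?size_mkseq //; have := mono _ _ mi; lia.
exists (mkseq f m); split=> //; last first.
  move=> i; rewrite nuE nth_nseq; case: ltnP => ri; first exact: in_rect_le fR.
  by rewrite (in_rect0 fR ri).
apply/andP; split.
  apply/(sortedP 0%N) => i; rewrite size_mkseq => im; rewrite !nuE.
  exact: mono.
apply/negP => /mapP[i]; rewrite mem_iota => /= im fi.
by have := mmin i; rewrite -fi => /(_ isT); lia.
Qed.

Lemma skew_V_skew_prod nu : is_partition nu -> part_incl nu (rect c r) ->
  skew_V k (rect c r ++ nu) nu = skew_prod k c r (nth 0%N nu).
Proof.
move=> nuP inc; have sz := size_partition_in_rect nuP inc.
rewrite /skew_V /skew_word /word_prod big_flatten big_map /skew_prod.
rewrite size_cat size_nseq iotaD rev_cat big_cat /=; congr (_ * _)%g.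
  have -> : iota (0 + r) (size nu) = [seq (r + i)%N | i <- iota 0 (size nu)].
    by rewrite -iotaDl addn0.
  (* When [nu] has fewer than [r] parts, the rows missing from the lower copy are empty and
     contribute 1. *)
  have -> : iota 0 r = iota 0 (size nu) ++ iota (size nu) (r - size nu).
    by rewrite -iotaD subnKC.
  rewrite -map_rev big_map rev_cat big_cat /= [X in (X * _)%g]big1_seq
    ?mul1g; last first.
    move=> i /=; rewrite mem_rev mem_iota => /andP[si _].
    by rewrite /row_prod nth_default // word_prod_nil.
  apply: eq_bigr => i _; rewrite nth_cat size_nseq ltnNge leq_addr /= addKn.
  rewrite [nth 0%N nu (r + i)]nth_default //; exact: leq_trans sz (leq_addr _ _).
rewrite big_seq [RHS]big_seq; apply: eq_bigr => i.
by rewrite mem_rev mem_iota => /= ir; rewrite nth_cat size_nseq ir nth_nseq ir.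
Qed.

Hypothesis cr : (c + r)%N = k.+1.

(** With [d = r - j], the block of index [j] in [phi] consists of the integers strictly between
    [E d.+1] and [E d]. The values [E 1, ..., E r] are the steps, while [E 0 = c - r + 1] and
    [E r.+1 = - 2r] delimit a window of one period, so the blocks fill exactly the gaps between the
    steps. *)
Lemma phiE nu : is_partition nu -> part_incl nu (rect c r) ->
  phi k c r nu = ~: steps (nth 0%N nu).
Proof.
move=> nuP inc; have fR := partition_in_rect nuP inc.
set f := nth 0%N nu in fR *.
pose E d : int := (nth 0%N (c :: nu) d)%:Z - r%:Z - d%:Z + 1.
have ES d : E d.+1 = lattice_step r f d by rewrite /E /lattice_step /= -/f; lia.
have E0 : E 0%N = c%:Z - r%:Z + 1 by rewrite /E /= subr0.
have Ele d : E d <= E 0%N.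
  case: d => [|d]; first by lia.
  have := in_rect_le d fR; rewrite ES E0 /lattice_step; lia.
apply/setP => x; rewrite in_setC.
have [z zw ->] := residue_surj (1 - 2 * r%:Z) x.
apply/bigcupP/idP => [[j _]|nz].
  rewrite inE => /asboolP[i [i1 i2 /eqP]].
  pose d := (r - j)%N.
  have jr : (j <= r)%N by rewrite -ltnS.
  have iE : i < E d by rewrite /E /d; lia.
  have iES : E d.+1 < i by rewrite /E /d; lia.
  have iw : 1 - 2 * r%:Z <= i < 1 - 2 * r%:Z + k.+1%:Z.
    rewrite -cr; have := Ele d; rewrite E0.
    by have := leq_subr j r; rewrite -/d; move: iES; rewrite ES /lattice_step; lia.
  move=> /eqP ->; apply/step_setP => -[p pr].
  move=> /residue_inj_window e; have {}e := e _ iw (lattice_step_window cr fR pr).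
  have Lle q q' : (q <= q')%N -> lattice_step r f q' <= lattice_step r f q.
    by case: fR => mono _ _ h; have := mono _ _ h; rewrite /lattice_step; lia.
  have [pd|dp] := ltnP p d; last by have := Lle _ _ dp; rewrite -(ES d) -e; lia.
  have pd1 : (p <= d.-1)%N by lia.
  have := Lle _ _ pd1; rewrite -(ES d.-1) prednK -?e; lia.
have ex : exists d, (d <= r)%N && (z < E d).
  by exists 0%N; rewrite leq0n E0; move: zw; rewrite -cr; lia.
have ub d : (d <= r)%N && (z < E d) -> (d <= r)%N by case/andP.
(* The gap containing [z] lies just below the last [E d] that exceeds [z]. *)
case: (ex_maxnP ex ub) => d /andP[dr zE] dmax.
have zES : E d.+1 < z.
  have [dr'|rd] := ltnP d r; last first.
    rewrite ES /lattice_step (in_rect0 fR rd); lia.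
  have [//|[e|h]] : E d.+1 < z \/ z = E d.+1 \/ z < E d.+1 by lia.
    by case/negP: nz; apply/step_setP; exists d => //; rewrite e ES.
  by have := dmax d.+1; rewrite dr' h => /(_ isT); rewrite ltnn.
have jr : (r - d < r.+1)%N by lia.
exists (Ordinal jr) => //; rewrite inE; apply/asboolP; exists z.
by rewrite /= subKn //; split=> //; move: zE zES; rewrite /E /=; lia.
Qed.

(** At the first row where they differ, the larger step would have to be a step of the other
    function: earlier rows agree and have strictly larger steps, while that row and later ones have
    smaller steps. *)
Lemma step_set_inj f g : in_rect f -> in_rect g -> steps f = steps g -> f =1 g.
Proof.
have key f' g' p : in_rect f' -> in_rect g' -> steps f' = steps g' ->
    (p < r)%N -> (forall q, (q < p)%N -> f' q = g' q) -> (f' p <= g' p)%N.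
  move=> fR gR e pr IH; rewrite leqNgt; apply/negP => lt.
  have : res (lattice_step r f' p) \in steps g'.
    by rewrite -e; apply/step_setP; exists p.
  case/step_setP => q qr /residue_inj_window eq.
  have {}eq := eq _ (lattice_step_window cr fR pr) (lattice_step_window cr gR qr).
  have [qp|pq] := ltnP q p.
    have := lattice_step_mono fR qp; rewrite eq /lattice_step IH //; lia.
  move: eq; case: gR => mono _ _; have := mono _ _ pq; rewrite /lattice_step; lia.
move=> fR gR e p; have [rp|pr] := leqP r p.
  by rewrite (in_rect0 fR) // (in_rect0 gR).
elim/ltn_ind: p pr => p IH pr.
have IH' q : (q < p)%N -> f q = g q.
  by move=> qp; apply: IH => //; exact: ltn_trans qp pr.
apply/eqP; rewrite eqn_leq (key f g p fR gR e pr IH').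
by apply: (key g f p gR fR (esym e) pr) => q /IH'.
Qed.

Lemma card_step_set f : in_rect f -> #|steps f| = r.
Proof.
move=> fR; rewrite card_imset ?card_ord // => p q e.
by apply/val_inj/(lattice_step_inj cr fR) => //; exact: ltn_ord.
Qed.

(** The positions of [A] in the window are listed increasingly as [e]. Steps decrease with the row,
    so row [p] takes the entry of index [r - 1 - p]; subtracting this index yields the part. *)
Lemma step_set_surj A : #|A| = r -> exists2 f, in_rect f & steps f = A.
Proof.
move=> cA; pose h (t : nat) := res (t%:Z + (1 - 2 * r%:Z)).
pose e := [seq t <- iota 0 k.+1 | h t \in A].
have hw t : (t < k.+1)%N ->
    1 - 2 * r%:Z <= t%:Z + (1 - 2 * r%:Z) < 1 - 2 * r%:Z + k.+1%:Z by lia.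
have se : size e = r.
  rewrite -cA cardE size_filter /enum_mem size_filter -(count_map h (mem A)).
  apply/seq.permP/uniq_perm; [|by rewrite -enumT enum_uniq|].
    rewrite map_inj_in_uniq ?iota_uniq // => t u; rewrite !mem_iota => tk uk.
    by move/residue_inj_window => /(_ _ (hw _ tk) (hw _ uk)); lia.
  move=> x; rewrite -enumT mem_enum; apply/mapP.
  have [z zw ->] := residue_surj (1 - 2 * r%:Z) x.
  exists (absz (z - (1 - 2 * r%:Z))%R); first by rewrite mem_iota; lia.
  by congr residue; lia.
have sorted_e : sorted ltn e 
  by apply: (sorted_filter ltn_trans); exact: iota_ltn_sorted.
pose E i := nth 0%N e i.
(* Strictly increasing entries minus their indices are weakly increasing, which makes [f] weakly
   decreasing in [p]. *)
have ES i d : (i + d < r)%N -> (E i + d <= E (i + d))%N.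
  elim: d => [|d IH] h1; first by rewrite !addn0.
  have : (E (i + d) < E (i + d.+1))%N.
    by apply: (sorted_ltn_nth ltn_trans 0%N sorted_e); rewrite ?inE ?se; lia.
  by have := IH ltac:(lia); lia.
have Emem i : (i < r)%N -> E i \in e by move=> ir; rewrite mem_nth ?se.
have Ek i : (i < r)%N -> (E i <= k)%N.
  by move=> /Emem; rewrite mem_filter mem_iota => /andP[_]; lia.
pose f p := (if (p < r)%N then E (r.-1 - p)%N - (r.-1 - p) else 0)%N.
have fR : in_rect f.
  split; last by rewrite /f ltnn.
    move=> i j ij; rewrite /f; case: ltnP => // jr; rewrite (leq_ltn_trans ij jr).
    have := ES (r.-1 - j)%N (j - i)%N.
    have -> : (r.-1 - j + (j - i) = r.-1 - i)%N by lia.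
    move=> /(_ ltac:(lia)); lia.
  rewrite /f r_gt0 subn0; have := Ek r.-1; lia.
exists f => //; apply/eqP; rewrite eqEcard card_step_set // cA leqnn andbT.
apply/fintype.subsetP => x /step_setP[p pr ->]; have jr : (r.-1 - p < r)%N by lia.
have := Emem _ jr; rewrite mem_filter => /andP[+ _]; rewrite /h.
congr (residue _ _ \in A); rewrite /lattice_step /f pr.
by have := ES 0%N (r.-1 - p)%N; rewrite add0n => /(_ jr); lia.
Qed.

Lemma phi_bij : set_bij (partitions_in (rect c r))
  [set` [pred A : {set I} | #|A| == c]]%classic (phi k c r).
Proof.
split.
- move=> nu [nuP inc] /=; rewrite phiE //.
  have fR := partition_in_rect nuP inc.
  have := cardsC (steps (nth 0%N nu)); rewrite card_step_set // card_ord inE.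
  by move=> e; apply/eqP/(@addnI r); rewrite e addnC cr.
- move=> nu mu /set_mem[nuP inc] /set_mem[muP inc']; rewrite !phiE //.
  move=> /setC_inj /step_set_inj e; apply: eq_partition => //.
  by apply: e; exact: partition_in_rect.
- move=> A /=; rewrite inE => /eqP cA.
  have cCA : #|~: A| = r by apply: (@addnI c); rewrite cr -{1}cA cardsC card_ord.
  have [f fR fA] := step_set_surj cCA.
  have [nu [nuP inc nuE]] := in_rect_partition fR.
  exists nu; first by [].
  rewrite phiE //; have -> : nth 0%N nu = f by apply/funext.
  by rewrite fA setCK.
Qed.

End PartitionsInRectangle.

(** * The nilCoxeter algebra *)

Section NilCoxeterImage.
Variables (F : comNzRingType) (k : nat).
Local Notation I := 'I_k.+1.

Definition nil_pi (x : {malg F[{fmonom I}]}) : nilA F k := (\pi_(nilA F k) x)%qT.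

Lemma nil_piM x y : nil_pi x * nil_pi y = nil_pi (x * y).
Proof. exact: pi_nilAM. Qed.

Lemma gen_u_comm (i j : I) : ~~ adjacent i j ->
  gen_u F i * gen_u F j = gen_u F j * gen_u F i.
Proof.
move=> ij; rewrite -![gen_u F _]/(nil_pi (freeU F _)) !nil_piM.
by apply/nilAP/NilGen; exact: NilComm.
Qed.

Lemma gen_u_braid (i : I) : gen_u F i * gen_u F (ordS i) * gen_u F i =
  gen_u F (ordS i) * gen_u F i * gen_u F (ordS i).
Proof.
rewrite -![gen_u F _]/(nil_pi (freeU F _)) !nil_piM.
by apply/nilAP/NilGen; exact: NilBraid.
Qed.

(** The reduced word chosen inside [nil_u] is unknown; [matsumoto] exchanges it for [a]. *)
Lemma nil_u_reduced (a : seq I) : (0 < k)%N -> reduced a ->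
  nil_u F (word_prod a) = \prod_(i <- a) gen_u F i.
Proof.
move=> k_gt0 ra; rewrite /nil_u; case: cid => b /= /reduced_wordE[e rb].
exact: (matsumoto k_gt0 gen_u_comm gen_u_braid).
Qed.

Lemma v_tildeE r (A : {set I}) :
  v_tilde F r A = \prod_(i <- v_word r A) gen_u F i.
Proof. by rewrite /v_word big_flatten big_map /v_tilde /index_iota subn0. Qed.

End NilCoxeterImage.

Theorem theorem3p11 (F : comNzRingType) (k c r : nat)
    (k_ge1 : (1 <= k)%N) (c_ge1 : (1 <= c)%N) (r_ge1 : (1 <= r)%N)
    (cr : (c + r)%N = k.+1) :
  (forall nu : seq nat, is_partition nu -> part_incl nu (rect c r) ->
     nil_u F (skew_V k (rect c r ++ nu) nu) = v_tilde F r (phi k c r nu)) /\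
  \sum_(nu \in partitions_in (rect c r))
     nil_u F (skew_V k (rect c r ++ nu) nu) = Z_rect F k c r.
Proof.
have bij := phi_bij r_ge1 cr.
have main nu : is_partition nu -> part_incl nu (rect c r) ->
    nil_u F (skew_V k (rect c r ++ nu) nu) = v_tilde F r (phi k c r nu).
  move=> nuP inc; have fR := partition_in_rect r_ge1 nuP inc.
  rewrite skew_V_skew_prod // skew_prod_v_word // -(phiE (c := c)) // v_tildeE.
  apply: nil_u_reduced => //; apply: (@reduced_v_word k k_ge1 c) => //.
  by case: bij => /(_ nu (conj nuP inc)) /= /eqP.
(* The sum over subsets becomes a sum over a finite set in order to be reindexed along [phi]. *)
split=> //; rewrite /Z_rect [RHS]bigfs ?index_enum_uniq //; last first.
  by move=> A _; rewrite mem_index_enum.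
rewrite [RHS](reindex_fsbig _ _ _ _ bij).
by apply: eq_fsbigr => nu /set_mem[nuP inc]; exact: main.
Qed.
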